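(* For every partition $\lambda$ with at most $n$ parts, $$U_{\lambda,(1^n)}(q)=q^{\,n-|\lambda|}\,X_{\lambda,(1^n)}(q).$$
   Context: Fix $n\ge1$, $(1^n)=(1,\dots,1)$, $\rho_n=(n,\dots,1)$, $|\beta|=\sum\beta_i$, $x^\beta=\prod x_i^{\beta_i}$; $S_n$ permutes coordinates, $l(\sigma)$ = number of inversions. $F_q(\beta)$ is the coefficient of $x^\beta$ in $\prod_{1\le i<j\le n}(1-qx_i/x_j)^{-1}\prod_{1\le r\le s\le n}(1-\frac{q}{x_rx_s})^{-1}$, and $U_{\lambda,\mu}(q)=\sum_{\sigma\in S_n}(-1)^{l(\sigma)}F_q(\sigma(\lambda+\rho_n)-\mu-\rho_n)$. One dimension sum for $\mu=(1^n)$: let $\mathcal{C}_n$ be the ordered alphabet $1<\cdots<n<\bar n<\cdots<\bar1$ with $\mathrm{wt}(k)=\varepsilon_k$, $\mathrm{wt}(\bar k)=-\varepsilon_k$. $E_\lambda$ is the set of words $x_1\otimes\cdots\otimes x_n$ over $\mathcal{C}_n$ such that each partial sum $w_i=\sum_{j\le i}\mathrm{wt}(x_j)$ ($1\le i\le n$) is a partition and $w_n=\lambda$ (the highest weight vertices of weight $\lambda$ in the $U_q(\mathfrak{sp}_{2n})$-crystal $B(\Lambda_1)^{\otimes n}$, Kashiwara's convention). With $H(x\otimes y)=1$ if $x\ge y$ and $0$ otherwise, $X_{\lambda,(1^n)}(q)=\sum_{b\in E_\lambda}q^{\sum_{i=1}^{n-1}(n-i)H(x_i\otimes x_{i+1})}$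 (the $C_n^{(1)}$ one dimension sum of Hatayama–Kuniba–Okado–Takagi specialized to $\mu=(1^n)$). *)

(* Defs.v *)
From mathcomp Require Import all_boot all_order all_algebra fingroup perm.
Set Implicit Arguments. Unset Strict Implicit. Unset Printing Implicit Defensive.
Import GRing.Theory Num.Theory.
Local Open Scope ring_scope.

(* Conventions: coordinates are indexed by 'I_n, 0-based: coordinate i
   stands for the paper's index i+1.  Weights live in Z^n = ('I_n -> int). *)

Definition rho (n : nat) (i : 'I_n) : int := (n - i)%N%:Z.

(* Coefficient of q^k x^beta in
     prod_{i<j} (1 - q x_i/x_j)^{-1} prod_{r<=s} (1 - q/(x_r x_s))^{-1}.
   Expanding the geometric series, this is the number of families of
   nonnegative integers a_(i,j) (i<j) and b_(r,s) (r<=s) with total sum k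
   and  sum a_(i,j) (e_i - e_j) - sum b_(r,s) (e_r + e_s) = beta.
   Every entry is <= k, so entries are taken in 'I_k.+1; unused index pairs
   are forced to 0. *)
Definition Fcoef (n : nat) (beta : 'I_n -> int) (k : nat) : nat :=
  #|[pred ab : {ffun 'I_n * 'I_n -> 'I_k.+1} * {ffun 'I_n * 'I_n -> 'I_k.+1} |
     [&& [forall p : 'I_n * 'I_n, ~~ (p.1 < p.2)%N ==> (val (ab.1 p) == 0%N)],
         [forall p : 'I_n * 'I_n, (p.2 < p.1)%N ==> (val (ab.2 p) == 0%N)],
         (\sum_(p : 'I_n * 'I_n) val (ab.1 p) + \sum_(p : 'I_n * 'I_n) val (ab.2 p) == k)%N
       & [forall t : 'I_n,
           \sum_(p : 'I_n * 'I_n) (val (ab.1 p))%:Z * ((p.1 == t)%:Z - (p.2 == t)%:Z)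
         - \sum_(p : 'I_n * 'I_n) (val (ab.2 p))%:Z * ((p.1 == t)%:Z + (p.2 == t)%:Z)
           == beta t]]]|.

(* F_q(beta) as its coefficient function on integer exponents (a formal power
   series in q, zero in negative degrees). *)
Definition Fq (n : nat) (beta : 'I_n -> int) (k : int) : int :=
  if k is Posz m then (Fcoef beta m)%:Z else 0.

(* Coefficient of q^k in U_{lambda,mu}(q)
   = sum_sigma (-1)^{l(sigma)} F_q(sigma(lambda+rho) - mu - rho),
   with (sigma v)_i = v_{sigma^{-1} i} and (-1)^{l(sigma)} the sign of sigma. *)
Definition Ucoef (n : nat) (lam mu : 'I_n -> nat) (k : int) : int :=
  \sum_(s : 'S_n) (-1) ^+ odd_perm s *
     Fq (fun i : 'I_n => (lam ((s^-1)%g i))%:Z + rho ((s^-1)%g i) - (mu i)%:Z - rho i) k.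

(* The alphabet C_n: inl i is the letter i+1, inr i is the letter bar(i+1). *)
Definition letter (n : nat) := ('I_n + 'I_n)%type.

(* Position in the total order 1 < ... < n < bar n < ... < bar 1. *)
Definition letter_rank (n : nat) (x : letter n) : nat :=
  match x with inl i => val i | inr i => (2 * n - 1 - val i)%N end.

Definition letter_wt (n : nat) (x : letter n) (t : 'I_n) : int :=
  match x with inl i => (i == t)%:Z | inr i => - (i == t)%:Z end.

Definition Hloc (n : nat) (x y : letter n) : nat :=
  (letter_rank y <= letter_rank x)%N.

(* partial sum w_p = sum_{j <= p} wt(x_j) (paper's 1-based p). *)
Definition psum (n : nat) (w : {ffun 'I_n -> letter n}) (p : nat) (t : 'I_n) : int :=
  \sum_(j < n | (j < p)%N) letter_wt (w j) t.

Definition is_partition_vec (n : nat) (v : 'I_n -> int) : bool :=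
  [forall t : 'I_n, 0 <= v t] &&
  [forall i : 'I_n, forall j : 'I_n, (i <= j)%N ==> (v j <= v i)].

Definition Eset (n : nat) (lam : 'I_n -> nat) : pred {ffun 'I_n -> letter n} :=
  [pred w | [forall p : 'I_n, is_partition_vec (psum w p.+1)]
            && [forall t : 'I_n, psum w n t == (lam t)%:Z]].

(* sum_{i=1}^{n-1} (n-i) H(x_i (x) x_{i+1}); 0-based: pairs (i, j=i+1), weight n-j. *)
Definition energy (n : nat) (w : {ffun 'I_n -> letter n}) : nat :=
  \sum_(i < n) \sum_(j < n | val j == (val i).+1) ((n - j) * Hloc (w i) (w j))%N.

Definition Xcoef (n : nat) (lam : 'I_n -> nat) (k : int) : int :=
  if k is Posz m then
    #|[pred w : {ffun 'I_n -> letter n} | (w \in Eset lam) && (energy w == m)]|%:Z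
  else 0.

(* Main.v *)
Require Import Defs.
From mathcomp Require Import all_boot all_order all_algebra fingroup perm.
From mathcomp Require Import zify ring lra.
Import Order.TTheory GRing.Theory Num.Theory.
Set Implicit Arguments. Unset Strict Implicit. Unset Printing Implicit Defensive.
Local Open Scope ring_scope.

(* Both sides, evaluated at a number q > 1, are multiples of one determinant. Put
   e_k = q^(k(k-1)/2) / (q;q)_k, p = lambda + rho and D(p) = det (e_(p_i - n + j)), and
   let C_M be the coefficients of prod_(i <= j) (1 - w q^(i+j))^-1. For |lambda| = n - 2M,
     X = (q;q)_n C_M D(p)   and   U = q^(2M) (q;q)_n C_M D(p),
   while both vanish for the other lambda. This uses the Pieri rules
   sum_(|d| = a) D(p + d) = e_a D(p) and sum_(|S| = s) D(p + 1_S) = h_s D(p), which hold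
   for D, without the terms with more than n rows, because all sizes stay at most n.

   For U: expanding the product in the first variable expresses U_n(p) through U_(n-1) of
   p with one entry removed and shifted upwards. By the Pieri rule the result is D(p) with
   a new first column, a combination of the columns d_k = q^k e_k; the relation
   e_k = d_k + d_(k-1) evaluates it.

   For X: cutting a word into strictly increasing blocks, the generating series T(u) of the
   words leading from a given shape to a fixed one satisfies T(u) = A(u) T(qu), where A(u)
   runs over one block. On functions of p which are antisymmetric and vanish at p_i = 0, the
   condition of staying in the Weyl chamber may be dropped inside a block. So the words from
   0 to lambda are a signed sum over the Weyl group of type C of unrestricted words, which is
   symmetric in the two ends; and the words from lambda to 0 are C_M D(p), since this
   expression solves the same equation. *)

(** * Determinants and the Pieri rules *)

(** An entry never exceeds the total [a], so a box already containing [0, a] can be enlarged without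
    gaining a family. Pieri sums can thus be moved to a box as large as convenient. *)
Lemma box_sum_ext (I : finType) (V : nmodType) (F : {ffun I -> nat} -> V)
    (a B B' : nat) : (a <= B)%N -> (B <= B')%N ->
  \sum_(d : {ffun I -> 'I_B.+1} | (\sum_i d i == a)%N) F [ffun i => val (d i)] =
  \sum_(d : {ffun I -> 'I_B'.+1} | (\sum_i d i == a)%N) F [ffun i => val (d i)].
Proof.
move=> aB BB'.
have entry_le (C : nat) (d : {ffun I -> 'I_C.+1}) i :
    (\sum_j d j == a)%N -> (d i <= a)%N.
  by move=> /eqP <-; rewrite (bigD1 i) //= leq_addr.
pose h (d : {ffun I -> 'I_B'.+1}) : {ffun I -> 'I_B.+1} := [ffun i => inord (d i)].
pose h' (d : {ffun I -> 'I_B.+1}) : {ffun I -> 'I_B'.+1} := [ffun i => inord (d i)].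
have hE (d : {ffun I -> 'I_B'.+1}) i : (\sum_j d j == a)%N -> h d i = d i :> nat.
  by move=> Hd; rewrite ffunE inordK // ltnS (leq_trans (entry_le _ _ _ Hd)).
have h'E (d : {ffun I -> 'I_B.+1}) i : h' d i = d i :> nat.
  by rewrite ffunE inordK // ltnS (leq_trans _ BB') // -ltnS.
rewrite (reindex_onto h h'); last first.
  by move=> d _; apply/ffunP=> i; apply: val_inj; rewrite ffunE /= h'E inordK.
have hh (d : {ffun I -> 'I_B'.+1}) : (\sum_i h d i == a)%N && (h' (h d) == d) = (\sum_i d i == a)%N.
  apply/andP/idP => [[/eqP Hs /eqP Hd]|Hd].
    rewrite -Hs -{1}Hd; apply/eqP/eq_bigr => i _; exact: h'E.
  split; first by rewrite (eq_bigr (fun i => d i : nat)) // => i _; rewrite hE.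
  by apply/eqP/ffunP=> i; apply: val_inj; rewrite /= h'E hE.
apply: eq_big => d; first exact: hh.
rewrite hh => Hd; congr F; apply/ffunP=> i.
by rewrite [LHS]ffunE [RHS]ffunE /=; exact: hE.
Qed.

Section RowDet.
Variables (R : comNzRingType) (f : int -> R).

(** The Jacobi-Trudi determinant in the coordinates [p = lambda + rho]: its entries are f (lambda_i
    - i + j). *)
Definition row_det n (p : 'I_n -> int) : R :=
  \det (\matrix_(i, j) f (p i - n%:Z + j%:Z)).

Lemma eq_row_det n (p p' : 'I_n -> int) : p =1 p' -> row_det p = row_det p'.
Proof.
by move=> E; congr (\det _); apply/matrixP=> i j; rewrite !mxE E.
Qed.

Lemma row_det_perm n (p : 'I_n -> int) (s : 'S_n) :
  row_det (fun i => p (s i)) = (-1) ^+ odd_perm s * row_det p.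
Proof.
rewrite -[(-1) ^+ _ in RHS]det_perm -det_mulmx -row_permE; congr (\det _).
by apply/matrixP=> i j; rewrite !mxE.
Qed.

Lemma row_det_alt n (p : 'I_n -> int) i1 i2 :
  i1 != i2 -> p i1 = p i2 -> row_det p = 0.
Proof.
by move=> ne e; apply: (determinant_alternate ne) => j; rewrite !mxE e.
Qed.

Hypothesis f_neg : forall k : int, k < 0 -> f k = 0.

Lemma row_det_nonpos n (p : 'I_n -> int) i : p i <= 0 -> row_det p = 0.
Proof.
move=> pi; rewrite /row_det (expand_det_row _ i) big1 // => j _.
by rewrite !mxE f_neg ?mul0r //; have := ltn_ord j; lia.
Qed.

End RowDet.

Lemma det_lower_unit (R : comNzRingType) n (A : 'M[R]_n) :
  (forall i j : 'I_n, (i < j)%N -> A i j = 0) -> (forall i, A i i = 1) ->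
  \det A = 1.
Proof.
move=> A0 A1; rewrite det_trig; first by rewrite big1.
by apply/is_trig_mxP.
Qed.

(* An entry of [p] equal to 1 makes the row (0, ..., 0, f 0) appear in [row_det p]; the
   bounded support [L] of [f] makes the column operation c_j - t c_(j+1) exact. *)
Lemma pieri_bounded_support (R : comNzRingType) (f : int -> R) n (p : 'I_n -> int)
    (i0 : 'I_n) (L B a : nat) :
  (forall k, k < 0 -> f k = 0) -> (forall k : int, L%:Z < k -> f k = 0) ->
  f 0 = 1 -> (forall i, 0 < p i) -> p i0 = 1 -> (L + n <= B)%N -> (a <= B)%N ->
  \sum_(d : {ffun 'I_n -> 'I_B.+1} | (\sum_i d i == a)%N)
      row_det f (fun i => p i + (d i)%:Z) = f a%:Z * row_det f p.
Proof.
case: n p i0 => [p [] //|n p i0] f_neg f_big f0 p_pos pi0 LB aB.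
(* Generating polynomial of the shifts of one matrix entry. Consecutive columns telescope in [rS]:
   the one surplus term has index above [L], because [p i] is positive and [B] is at least [L] plus
   the size of the matrix. *)
pose r (i : 'I_n.+1) (j : nat) : {poly R} :=
  \sum_(d < B.+1) f (p i - n.+1%:Z + j%:Z + d%:Z) *: 'X^d.
have rS i j : r i j - 'X * r i j.+1 = (f (p i - n.+1%:Z + j%:Z))%:P.
  rewrite /r big_ord_recl /= expr0 alg_polyC addr0 [in X in _ - _ * X]big_ord_recr /=.
  rewrite (f_big (_ + _ + B%:Z)); last by have := p_pos i; lia.
  rewrite scale0r addr0 mulr_sumr -addrA -sumrB big1 ?addr0 // => d _.
  rewrite -scalerAr -exprS /bump /= add1n.
  rewrite (_ : _ + j.+1%:Z + d%:Z = p i - n.+1%:Z + j%:Z + d.+1%:Z) ?subrr //.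
  by rewrite -!addrA; congr (_ + _); lia.
pose M : 'M[{poly R}]_n.+1 := \matrix_(i, j) r i j.
(* Multilinearity in the rows: [\det M] is the generating polynomial of the wanted sums, the
   exponent of 'X recording the total shift. *)
have detM : \det M =
    \sum_(d : {ffun 'I_n.+1 -> 'I_B.+1})
       row_det f (fun i => p i + (d i)%:Z) *: 'X^(\sum_i d i).
  rewrite /determinant.
  under eq_bigr => s _.
    under eq_bigr => i _ do rewrite mxE /r.
    rewrite bigA_distr_bigA /= mulr_sumr; over.
  rewrite exchange_big /=; apply: eq_bigr => d _.
  rewrite /row_det /determinant scaler_suml; apply: eq_bigr => s _.
  rewrite scaler_prod prodrXr -!mul_polyC polyCM rmorph_sign mulrA.
  congr (_ * (_)%:P * _); apply: eq_bigr => i _; rewrite mxE; congr f; lia.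
(* The unitriangular operation [T] leaves constants in all columns but the last. *)
pose C : 'M[{poly R}]_n.+1 :=
  \matrix_(i, j) if (j < n)%N then (f (p i - n.+1%:Z + j%:Z))%:P else r i j.
pose T : 'M[{poly R}]_n.+1 :=
  \matrix_(i, j) ((i == j)%:R - 'X * ((i == j.+1 :> nat)%:R)).
have MT : M *m T = C.
  apply/matrixP=> i j; rewrite !mxE.
  under eq_bigr => k _ do rewrite !mxE mulrBr.
  rewrite sumrB (bigD1 j) //= eqxx mulr1 big1 ?addr0; last first.
    by move=> k /negbTE ->; rewrite mulr0.
  case: ifP => jn.
    have jk : (j.+1 < n.+1)%N by rewrite ltnS.
    rewrite (bigD1 (Ordinal jk)) //= eqxx mulr1 big1 ?addr0; last first.
      by move=> k; rewrite -val_eqE /= => /negbTE ->; rewrite !mulr0.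
    by rewrite mulrC rS.
  rewrite big1 ?subr0 // => k _; case: eqP => [kj|]; last by rewrite !mulr0.
  by have := ltn_ord k; rewrite kj ltnS jn.
have detT : \det T = 1.
  apply: det_lower_unit => [i j ij|i]; rewrite !mxE.
    rewrite -val_eqE /= ltn_eqF // ltn_eqF ?mulr0 ?subrr //; exact: leq_trans ij _.
  by rewrite eqxx ltn_eqF // mulr0 subr0.
have detMC : \det M = \det C by rewrite -MT det_mulmx detT mulr1.
(* Row [i0] has the arguments j - n, negative before the last column. Expanding along it leaves the
   same minor as in [row_det f p], where the last entry of that row is [f 0 = 1]. *)
have rowC (j : 'I_n.+1) : (j < n)%N -> C i0 j = 0.
  by move=> jn; rewrite mxE jn f_neg ?polyC0 // pi0; lia.
have detC : \det C = r i0 n * (row_det f p)%:P.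
  rewrite (expand_det_row _ i0) big_ord_recr /= big1 ?add0r; last first.
    by move=> j _; rewrite rowC ?mul0r //= ltn_ord.
  rewrite [C _ _]mxE ltnn; congr (_ * _).
  rewrite /row_det (expand_det_row _ i0) big_ord_recr /= big1 ?add0r; last first.
    by move=> j _; rewrite mxE f_neg ?mul0r // pi0 /=; have := ltn_ord j; lia.
  rewrite mxE pi0 /= (_ : 1 - _ + _ = 0) ?f0 ?mul1r; last by lia.
  rewrite /cofactor polyCM rmorphXn rmorphN1 -det_map_mx.
  congr (_ * \det _); apply/matrixP=> i j; rewrite !mxE /= ifT //.
  have jn : (j < n)%N by exact: ltn_ord.
  by rewrite /bump [(n <= j)%N]leqNgt jn.
have := congr1 (fun P : {poly R} => P`_a) (etrans (esym detM) (etrans detMC detC)).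
rewrite coef_sum coefMC.
have -> : (r i0 n)`_a = f a%:Z.
  rewrite /r pi0 coef_sum (bigD1 (Ordinal (aB : a < B.+1)%N)) //= coefZ coefXn eqxx.
  rewrite mulr1 big1 ?addr0; first by congr f; lia.
  by move=> d; rewrite -val_eqE /= coefZ coefXn eq_sym => /negbTE ->; rewrite mulr0.
move=> <-; rewrite [LHS]big_mkcond; apply: eq_bigr => d _.
by rewrite coefZ coefXn eq_sym; case: ifP => _; rewrite ?mulr1 ?mulr0.
Qed.

(** Among [n.+1] distinct naturals one is at least [n]; removing it gives the induction. *)
Lemma sum_inj_ord_ge n (p : 'I_n -> nat) :
  injective p -> (\sum_(i < n) i <= \sum_i p i)%N.
Proof.
elim: n p => [p _|n IHn p p_inj]; first by rewrite !big_ord0.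
have [i pi] : exists i, (n <= p i)%N.
  apply/existsP; apply: contraT => /existsPn small.
  have lt i : (p i < n)%N by rewrite ltnNge small.
  have := leq_card (fun i => Ordinal (lt i)) _; rewrite !card_ord ltnn; apply.
  by move=> i j /(congr1 val) /= /p_inj.
rewrite big_ord_recr /= (bigD1_ord i) //= addnC leq_add // IHn //.
by move=> j k /p_inj /lift_inj.
Qed.

Lemma sum_inj_pos_ge n (p : 'I_n -> int) (m : nat) :
  injective p -> (forall i, m%:Z <= p i) ->
  (\sum_(i < n) i)%N%:Z + (n * m)%N%:Z <= \sum_i p i.
Proof.
move=> p_inj p_ge; pose p' i := `|p i - m%:Z|%N.
have pE i : p i = (p' i)%:Z + m%:Z by have := p_ge i; rewrite /p'; lia.
have p'_inj : injective p'.
  by move=> i j e; apply: p_inj; rewrite !pE e.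
have := sum_inj_ord_ge p'_inj.
rewrite (eq_bigr _ (fun i _ => pE i)) big_split /= sumr_const card_ord.
rewrite -(big_morph Posz PoszD (erefl _)) -mulr_natr; lia.
Qed.

Lemma nat_injective_dec (n : nat) (T : eqType) (p : 'I_n -> T) :
  injective p \/ exists i j : 'I_n, i != j /\ p i = p j.
Proof.
have [/injectiveP|] := boolP (injectiveb p); first by left.
by move=> /injectivePn [i [j ne e]]; right; exists i, j.
Qed.

Section Pieri.
Variables (K : numFieldType) (f : int -> K).
Hypothesis f_neg : forall k : int, k < 0 -> f k = 0.
Hypothesis f0 : f 0 = 1.

Lemma eq_oppr0 (x : K) : x = - x -> x = 0.
Proof. by move=> /eqP; rewrite eq_sym eqNr => /eqP. Qed.

Lemma row_det_tperm n (p : 'I_n -> int) (i j : 'I_n) : i != j ->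
  row_det f (fun t => p (tperm i j t)) = - row_det f p.
Proof. by move=> ne; rewrite row_det_perm odd_tperm ne expr1 mulN1r. Qed.

(* If Sum p + a is at most n + n(n+1)/2 and the entries are distinct, then either
   a = 0 or some entry is 1. *)
Lemma pieri_complete n (p : 'I_n -> int) (B a : nat) :
  (forall i, 0 < p i) ->
  \sum_i p i + a%:Z <= (\sum_(i < n) i)%N%:Z + (n + n)%N%:Z -> (a <= B)%N ->
  \sum_(d : {ffun 'I_n -> 'I_B.+1} | (\sum_i d i == a)%N)
      row_det f (fun i => p i + (d i)%:Z) = f a%:Z * row_det f p.
Proof.
move=> p_pos p_le aB.
have [p_inj|[i [j [ne pij]]]] := nat_injective_dec p; last first.
  (* With two equal entries of [p], exchanging the corresponding entries of [d] permutes the terms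
     and reverses their signs. *)
  rewrite (row_det_alt f ne pij) mulr0; apply: eq_oppr0.
  pose h (d : {ffun 'I_n -> 'I_B.+1}) := [ffun t => d (tperm i j t)].
  have hK : involutive h by move=> d; apply/ffunP=> t; rewrite !ffunE tpermK.
  rewrite {1}(reindex_inj (inv_inj hK)) /= -sumrN; apply: eq_big => d.
    by rewrite [in RHS](reindex_inj (@perm_inj _ (tperm i j))) /=; congr (_ == _); apply: eq_bigr => t _; rewrite ffunE.
  move=> _; rewrite -(row_det_tperm _ ne); apply: eq_row_det => t; rewrite ffunE.
  by congr (_ + _); case: tpermP => [->|->|].
have [/existsP[i0 /eqP pi0]|/existsPn no1] := boolP [exists i, p i == 1]; last first.
  have p2 i : 2%N%:Z <= p i by have := p_pos i; have /eqP := no1 i; lia.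
  have := sum_inj_pos_ge p_inj p2 => p_ge.
  have -> : a = 0 by lia.
  rewrite f0 mul1r (big_pred1 [ffun=> ord0]) => [|d].
    by apply: eq_row_det => i; rewrite ffunE addr0.
  rewrite sum_nat_eq0; apply/forallP/eqP => [Hd|-> i]; last by rewrite ffunE.
  by apply/ffunP=> i; apply: val_inj; rewrite ffunE; apply/eqP; have := Hd i.
(* No argument of [f] in the determinants concerned exceeds [L], so [f] may be cut off above [L] to
   obtain bounded support. *)
pose L := (\sum_i `|p i| + a)%N.
pose f' (k : int) := if k <= L%:Z then f k else 0.
pose B' := (L + n + B)%N.
have trunc (d : 'I_n -> nat) : (\sum_i d i <= a)%N ->
    row_det f (fun i => p i + (d i)%:Z) = row_det f' (fun i => p i + (d i)%:Z).
  move=> da; congr (\det _); apply/matrixP=> i j; rewrite !mxE /f' ifT //.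
  have : (d i <= a)%N by apply: leq_trans da; rewrite (bigD1 i) //= leq_addr.
  have : (`|p i| <= \sum_i `|p i|)%N by rewrite (bigD1 i) //= leq_addr.
  by have := p_pos i; have := ltn_ord j; rewrite /L; lia.
pose F (g : {ffun 'I_n -> nat}) := row_det f (fun i => p i + (g i)%:Z).
transitivity (\sum_(d : {ffun 'I_n -> 'I_B.+1} | (\sum_i d i == a)%N)
      F [ffun i => val (d i)]).
  by apply: eq_bigr => d _; apply: eq_row_det => i; rewrite ffunE.
rewrite (box_sum_ext F aB (_ : B <= B')%N); last by rewrite leq_addl.
transitivity (\sum_(d : {ffun 'I_n -> 'I_B'.+1} | (\sum_i d i == a)%N)
      row_det f' (fun i => p i + (d i)%:Z)).
  apply: eq_bigr => d /eqP da; rewrite -trunc ?da //.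
  by apply: eq_row_det => i; rewrite ffunE.
rewrite (@pieri_bounded_support _ f' n p i0 L).
- rewrite /f' ifT; last by rewrite /L; lia.
  have := trunc (fun=> 0%N); rewrite big1 // => /(_ (leq0n _)) E.
  congr (_ * _); transitivity (row_det f (fun i => p i + 0)).
    by rewrite E; apply: eq_row_det => i; rewrite addr0.
  by apply: eq_row_det => i; rewrite addr0.
- by move=> k k0; rewrite /f' f_neg // if_same.
- by move=> k k0; rewrite /f' ifF //; apply/negbTE; rewrite -ltNge.
- by rewrite /f' f0.
- by [].
- by [].
- by rewrite /B'; lia.
- by rewrite /B'; lia.
Qed.

End Pieri.

(** * Passing from shifts by compositions to shifts by subsets *)

Section InclusionExclusion.
Variables (I : finType) (k : nat).
Let state := ({set I} * {ffun I -> 'I_k.+1})%type.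
Let tot (x : state) : {ffun I -> nat} := [ffun i => (x.2 i + (i \in x.1))%N].
Let toggle (x : state) : state :=
  if [pick i | (0 < tot x i)%N] is Some i then
    if i \in x.1 then (x.1 :\ i, [ffun t => if t == i then inord (x.2 t).+1 else x.2 t])
    else (i |: x.1, [ffun t => if t == i then inord (x.2 t).-1 else x.2 t])
  else x.

Let sum_tot (x : state) : (\sum_i tot x i = \sum_i x.2 i + #|x.1|)%N.
Proof.
under eq_bigr => i _ do rewrite ffunE.
rewrite big_split /=; congr (_ + _)%N; rewrite -sum1_card [RHS]big_mkcond.
by apply: eq_bigr => i _; case: (i \in _).
Qed.

(* Toggling the membership of the first i of the support of d + 1_S, with d i adjusted,
   keeps d + 1_S and reverses the sign. *)
Let toggleP (x : state) : (0 < k)%N -> (\sum_i tot x i = k)%N ->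
  [/\ tot (toggle x) = tot x, toggle (toggle x) = x &
      odd (\sum_i (toggle x).2 i) = ~~ odd (\sum_i x.2 i)].
Proof.
move=> k0 totk.
have [i ti toggleE] : exists2 i, (0 < tot x i)%N & (forall y, tot y = tot x -> toggle y =
    if i \in y.1 then (y.1 :\ i, [ffun t => if t == i then inord (y.2 t).+1 else y.2 t])
    else (i |: y.1, [ffun t => if t == i then inord (y.2 t).-1 else y.2 t])).
  case e: [pick i | (0 < tot x i)%N] => [i|].
    exists i; first by case: pickP e => // j tj [<-].
    by move=> y ty; rewrite /toggle ty e.
  case: pickP e => // t0 _; move: totk; rewrite big1 => [kk|i _].
    by rewrite -kk in k0.
  by have := t0 i; lia.
have xik : (x.2 i <= k - (i \in x.1))%N.
  have : (tot x i <= k)%N by rewrite -totk (bigD1 i) //= leq_addr.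
  by rewrite ffunE; case: (i \in x.1) => /=; lia.
have totE : tot (toggle x) = tot x.
  rewrite toggleE //; apply/ffunP=> t; move: ti; rewrite !ffunE.
  case: ifP => ix /= ti; rewrite !inE ffunE; case: eqP => [->|_] //=; rewrite ?ix ?andbF ?eqxx /=.
    by rewrite inordK; move: xik; rewrite ?ix; lia.
  by rewrite inordK; have := ltn_ord (x.2 i); move: ti; rewrite ?ix; lia.
split=> //.
  rewrite toggleE // [toggle x]toggleE //; case ix: (i \in x.1); rewrite /= !inE eqxx /=.
    rewrite (surjective_pairing x) /= setD1K //; congr (_, _); apply/ffunP=> t.
    rewrite !ffunE; case: eqP => // ->; apply: val_inj.
    have e : (inord (x.2 i).+1 : 'I_k.+1) = (x.2 i).+1 :> nat by move: xik; rewrite ix => ?; rewrite inordK; lia.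
    by rewrite /= inordK e //= ltnW.
  rewrite (surjective_pairing x) /= setU1K ?ix //; congr (_, _); apply/ffunP=> t.
  rewrite !ffunE; case: eqP => // ->; apply: val_inj.
  move: ti; rewrite ffunE ix addn0 => ti.
  have e : (inord (x.2 i).-1 : 'I_k.+1) = (x.2 i).-1 :> nat.
    by have := ltn_ord (x.2 i); rewrite inordK; lia.
  by rewrite /= inordK e ?prednK.
have par (y : state) : odd (\sum_i y.2 i) = odd (\sum_i tot y i) (+) odd #|y.1|.
  by rewrite sum_tot oddD; case: odd; case: odd.
rewrite !par totE toggleE // -addbN; congr (_ (+) _); case: ifP => ix /=.
  by rewrite [in RHS](cardsD1 i) ix oddD /= negbK.
by rewrite cardsU1 ix.
Qed.

(** The identity E(t) H(-t) = 1 with [F] in place of monomials: [toggle] pairs terms of opposite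
    sign. *)
Lemma incl_excl_sum (K : numFieldType) (F : {ffun I -> nat} -> K) : (0 < k)%N ->
  \sum_(S : {set I}) \sum_(d : {ffun I -> 'I_k.+1} | (\sum_i d i + #|S| == k)%N)
    (-1) ^+ (\sum_i d i)%N * F [ffun i => (d i + (i \in S))%N] = 0.
Proof.
move=> k0; rewrite pair_big_dep /=.
set G := BIG_F; set P := BIG_P.
have PE (x : state) : P x -> (\sum_i tot x i = k)%N by rewrite sum_tot => /eqP.
apply: eq_oppr0; rewrite {1}(reindex_onto toggle toggle) /=; last first.
  by move=> x /PE/(toggleP k0) [].
rewrite -sumrN; apply: eq_big => x.
  apply/andP/idP => [[Px /eqP e]|Px].
    have [t _ _] := toggleP k0 (PE _ Px); rewrite e in t.
    by move: (PE _ Px); rewrite /P -sum_tot t => ->.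
  have [t e _] := toggleP k0 (PE _ Px); rewrite e eqxx; split=> //.
  by rewrite /P -sum_tot t PE.
move=> /andP[Px /eqP e]; have [t _ o] := toggleP k0 (PE _ Px); rewrite e in t o.
rewrite /G -[in LHS]signr_odd -[in RHS]signr_odd o.
have -> : [ffun i => (x.2 i + (i \in x.1))%N] = tot x by [].
have -> : [ffun i => ((toggle x).2 i + (i \in (toggle x).1))%N] = tot x by rewrite t.
by case: (odd (\sum_i (toggle x).2 i)) => /=; ring.
Qed.

End InclusionExclusion.

Section PieriElementary.
Variables (K : numFieldType) (f : int -> K) (h : nat -> K).
Hypothesis f_neg : forall k : int, k < 0 -> f k = 0.
Hypothesis f0 : f 0 = 1.
Hypothesis fh : forall k,
  \sum_(a < k.+1) (-1) ^+ a * f a%:Z * h (k - a)%N = (k == 0%N)%:R.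

(** Inclusion-exclusion applied to the determinants, with its inner sums evaluated by
    [pieri_complete] at p + 1_S, gives the subset sums the same recursion as [fh] gives [h]. *)
Lemma pieri_elementary n (p : 'I_n -> int) (s : nat) :
  (forall i, 0 < p i) ->
  \sum_i p i + s%:Z <= (\sum_(i < n) i)%N%:Z + (n + n)%N%:Z ->
  \sum_(S : {set 'I_n} | #|S| == s) row_det f (fun i => p i + (i \in S)%:Z)
    = h s * row_det f p.
Proof.
move=> p_pos; elim/ltn_ind: s => s IH s_le.
have h0 : h 0 = 1.
  by have := fh 0; rewrite big_ord1 expr0 f0 !mul1r.
have [->|s0] := posnP s.
  rewrite h0 mul1r (big_pred1 set0) => [|S]; last by rewrite cards_eq0.
  by apply: eq_row_det => i; rewrite in_set0 addr0.
have := incl_excl_sum (fun g => row_det f (fun i : 'I_n => p i + (g i)%:Z)) s0.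
pose E a := \sum_(S : {set 'I_n} | #|S| == (s - a)%N) row_det f (fun i => p i + (i \in S)%:Z).
have -> : \sum_(S : {set 'I_n}) \sum_(d : {ffun 'I_n -> 'I_s.+1} | (\sum_i d i + #|S| == s)%N)
    (-1) ^+ (\sum_i d i)%N * row_det f (fun i =>
       p i + ([ffun i => (d i + (i \in S))%N] i)%:Z)
   = \sum_(a < s.+1) (-1) ^+ a * f a%:Z * E a.
  transitivity (\sum_(S : {set 'I_n}) \sum_(a < s.+1) if #|S| == (s - a)%N then
     (-1) ^+ a * f a%:Z * row_det f (fun i => p i + (i \in S)%:Z) else 0).
    apply: eq_bigr => S _.
    rewrite (partition_big (fun d : {ffun 'I_n -> 'I_s.+1} => inord (\sum_i d i)%N : 'I_s.+1) xpredT) //=.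
    apply: eq_bigr => a _; case: ifP => [/eqP cS|cS].
      rewrite -mulrA -(pieri_complete f_neg f0 _ _ (_ : a <= s)%N).
      - rewrite mulr_sumr; apply: eq_big => d.
          have sa : (a <= s)%N by rewrite -ltnS.
          rewrite cS; apply/andP/eqP => [[/eqP ds _]|ds].
            by have ds' : (\sum_i d i + (s - a))%N = s := ds; lia.
          rewrite ds subnKC // eqxx; split=> //.
          by apply/eqP/val_inj; rewrite /= inordK.
        move=> /andP[/eqP ds /eqP/(congr1 val)] /=.
        rewrite inordK => [<-|]; last by have := leq_addr #|S| (\sum_i d i); rewrite ds.
        congr (_ * _).
        by apply: eq_row_det => i; rewrite ffunE; lia.
      - by move=> i; have := p_pos i; lia.
      - rewrite big_split /= -(big_morph Posz PoszD (erefl _)) -big_mkcond sum1_card cS.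
        apply: le_trans s_le; rewrite -addrA lerD2l -PoszD lez_nat subnK //.
        by rewrite -ltnS.
      by have := ltn_ord a; lia.
    rewrite big_pred0 // => d; apply/negbTE; apply: contraFN cS => /andP[/eqP ds /eqP/(congr1 val)].
    have ds' : (\sum_i d i <= s)%N by have := leq_addr #|S| (\sum_i d i); rewrite ds.
    by rewrite /= inordK ?ltnS // => <-; rewrite -[X in X == _](addKn (\sum_i d i)%N) ds.
  rewrite exchange_big /=; apply: eq_bigr => a _.
  by rewrite /E mulr_sumr [RHS]big_mkcond.
(* Both recursions are solved for their term at [a = 0]; the other terms agree by induction. *)
move: (fh s); rewrite !big_ord_recl /= !expr0 !mul1r !f0 !mul1r !subn0.
rewrite (gtn_eqF s0) => /eqP; rewrite addr_eq0 => /eqP -> /eqP.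
rewrite addr_eq0 {1}/E subn0 => /eqP ->; rewrite mulNr; congr (- _).
rewrite mulr_suml; apply: eq_bigr => a _; rewrite -[RHS]mulrA; congr (_ * _).
rewrite /E IH //; first by rewrite /bump /=; lia.
by apply: le_trans s_le; rewrite lerD2l lez_nat leq_subr.
Qed.

End PieriElementary.

(** * The q-series *)

Section StrongRecursion.
Variables (T : Type) (dflt : T) (step : nat -> (nat -> T) -> T).

(** Course-of-values recursion: the values below [n] are tabulated, and [step] receives the whole
    table. *)
Fixpoint rec_table (n : nat) : nat -> T :=
  if n is m.+1 then fun k => if k == m then step m (rec_table m) else rec_table m k
  else fun=> dflt.

Definition strong_rec n := rec_table n.+1 n.

Lemma rec_tableE n k : (k < n)%N -> rec_table n k = strong_rec k.
Proof.
elim: n => // n IHn; rewrite ltnS leq_eqVlt => /predU1P[->//|kn].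
by rewrite /= (ltn_eqF kn) IHn.
Qed.

Lemma strong_recE n :
  (forall f g, (forall k, (k < n)%N -> f k = g k) -> step n f = step n g) ->
  strong_rec n = step n strong_rec.
Proof.
move=> ext; rewrite {1}/strong_rec /= eqxx; apply: ext => k kn.
exact: rec_tableE.
Qed.

End StrongRecursion.

Section Convolution.
Variable K : comNzRingType.
Implicit Types f g h : nat -> K.

Definition conv f g (n : nat) : K := \sum_(k < n.+1) f k * g (n - k)%N.

Let tr N f : {poly K} := \poly_(i < N.+1) f i.

(** Truncation at degree [N] does not affect coefficients up to [N], so the laws of [conv] come from
    polynomials. *)
Let conv_coef N f g n : (n <= N)%N -> conv f g n = (tr N f * tr N g)`_n.
Proof.
move=> nN; rewrite coefM; apply: eq_bigr => k _; rewrite !coef_poly.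
by rewrite !ltnS (leq_trans (leq_subr _ _) nN) (leq_trans _ nN) // -ltnS.
Qed.

Lemma eq_conv f f' g g' n : (forall k, (k <= n)%N -> f k = f' k) ->
  (forall k, (k <= n)%N -> g k = g' k) -> conv f g n = conv f' g' n.
Proof.
by move=> ef eg; apply: eq_bigr => k _; rewrite ef ?eg ?leq_subr // -ltnS.
Qed.

Lemma convA f g h n : conv f (conv g h) n = conv (conv f g) h n.
Proof.
rewrite !(@conv_coef n) //.
transitivity (tr n f * (tr n g * tr n h))`_n.
  rewrite !coefM; apply: eq_bigr => k _; congr (_ * _).
  by rewrite coef_poly ltnS leq_subr (@conv_coef n) ?leq_subr.
rewrite mulrA !coefM; apply: eq_bigr => k _; congr (_ * _).
by rewrite coef_poly ltn_ord (@conv_coef n) // -ltnS.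
Qed.

Lemma convC f g n : conv f g n = conv g f n.
Proof. by rewrite !(@conv_coef n) // mulrC. Qed.

Lemma conv_delta f n : conv (fun k => (k == 0%N)%:R) f n = f n.
Proof.
rewrite /conv big_ord_recl mul1r subn0 big1 ?addr0 // => k _.
by rewrite mul0r.
Qed.

End Convolution.

(** Regrouping by s = b + c; the corner of the square beyond [B] disappears because [G] vanishes
    there. *)
Lemma sum_antidiagonal (K : comNzRingType) B (F G : nat -> K) :
  (forall s, (B < s)%N -> G s = 0) ->
  \sum_(b < B.+1) \sum_(c < B.+1) F b * G (b + c)%N =
  \sum_(s < B.+1) G s * \sum_(b < s.+1) F b.
Proof.
move=> G0.
transitivity (\sum_(s < B.+1) \sum_(b < B.+1 | (b <= s)%N) F b * G s); last first.
  apply: eq_bigr => s _; rewrite mulr_sumr.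
  rewrite [RHS](big_ord_widen B.+1 (fun b => G s * F b)); last by rewrite ltnS -ltnS.
  by apply: eq_bigr => b _; rewrite mulrC.
rewrite [RHS](exchange_big_dep xpredT) //=; apply: eq_bigr => b _.
rewrite -[LHS](big_mkord xpredT (fun c => F b * G (b + c)%N)).
rewrite -[RHS](big_mkord (fun s => b <= s)%N (fun s => F b * G s)).
rewrite -(big_nat_widenl _ _ _ xpredT) // .
have -> : \sum_(0 <= c < B.+1) F b * G (b + c)%N = \sum_(b <= s < B.+1 + b) F b * G s.
  have := @big_addn _ 0 +%R 0 (B.+1 + b) b xpredT (fun s => F b * G s).
  by rewrite add0n addnK => ->; apply: eq_bigr => c _; rewrite addnC.
have bB : (b <= B.+1)%N by rewrite ltnW.
rewrite (big_cat_nat bB (leq_addr b B.+1)) /=.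
rewrite [X in _ + X]big1_seq ?addr0 // => s; rewrite mem_index_iota => /andP[_ /andP[sB _]].
by rewrite G0 ?mulr0.
Qed.

(** * Coefficients of the infinite q-products *)

Section QSeries.
Variables (K : numFieldType) (q : K).
Hypothesis q_gt1 : 1 < q.

Lemma q_gt0 : 0 < q. Proof. exact: lt_trans ltr01 q_gt1. Qed.
Lemma q_neq0 : q != 0. Proof. by rewrite gt_eqF // q_gt0. Qed.

Lemma one_sub_qX_neq0 k : (0 < k)%N -> 1 - q ^+ k != 0.
Proof. by move=> k0; rewrite subr_eq0 eq_sym gt_eqF // exprn_egt1 // -lt0n. Qed.

Definition qfact k : K := \prod_(i < k) (1 - q ^+ i.+1).

Lemma qfactS k : qfact k.+1 = qfact k * (1 - q ^+ k.+1).
Proof. by rewrite /qfact big_ord_recr. Qed.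

Lemma qfact_neq0 k : qfact k != 0.
Proof. by apply/prodf_neq0 => i _; rewrite one_sub_qX_neq0. Qed.

(* e_k(1, q, q^2, ...) = q^(k(k-1)/2) / (q;q)_k, read as a rational function of q. *)
Definition ecoef (k : int) : K := if k is Posz m then q ^+ 'C(m, 2) / qfact m else 0.
(** This is e_k(q, q^2, ...). *)
Definition dcoef (k : int) : K := q ^ k * ecoef k.

Lemma dcoefE k : dcoef k = q ^ k * ecoef k. Proof. by []. Qed.

Lemma ecoef_neg (k : int) : k < 0 -> ecoef k = 0.
Proof. by case: k. Qed.

Lemma ecoef0 : ecoef 0 = 1.
Proof. by rewrite /= /qfact big_ord0 divr1. Qed.

(** Among the variables 1, q, q^2, ..., the variable 1 is either avoided or used once. *)
Lemma ecoefE k : ecoef k = dcoef k + dcoef (k - 1).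
Proof.
case: k => [[|m]|m].
- by rewrite /dcoef mulr0 addr0 expr0z mul1r.
- rewrite /dcoef (_ : m.+1%:Z - 1 = m) /=; last by lia.
  rewrite -!exprnP qfactS binS bin1 exprD.
  by field; rewrite qfact_neq0 one_sub_qX_neq0.
- by rewrite /dcoef !ecoef_neg ?mulr0 ?addr0 //; lia.
Qed.

(** Adjoining the variable q^-1 to 1, q, q^2, ... multiplies the whole list by q^-1; algebraically,
    a rescaled [ecoefE]. *)
Lemma ecoef_qV k : ecoef k + q^-1 * ecoef (k - 1) = q ^ (- k) * ecoef k.
Proof.
have q0 := q_neq0.
rewrite [in RHS]ecoefE /dcoef mulrDr !mulrA -!expfzDr // addNr expr0z mul1r.
by rewrite (_ : - k + (k - 1) = -1) ?exprN1 //; lia.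
Qed.

(** The coefficients of (w; q)_oo. *)
Definition sgn_e (k : nat) : K := (-1) ^+ k * ecoef k%:Z.

(** Partial sums are coefficients of (w; q)_oo / (1 - w) = (q w; q)_oo. *)
Lemma sum_sgn_e s : \sum_(b < s.+1) sgn_e b = q ^+ s * sgn_e s.
Proof.
elim: s => [|s IHs]; first by rewrite big_ord1 expr0 mul1r.
rewrite big_ord_recr /= IHs /sgn_e [X in _ + _ * X]ecoefE /dcoef.
rewrite (_ : s.+1%:Z - 1 = s) -?exprnP; last by lia.
by rewrite [(-1) ^+ s.+1]exprS; ring.
Qed.

(** The coefficients of 1 / (w; q)_oo, which are the complete symmetric functions of 1, q, q^2,
    ... *)
Definition hcoef : nat -> K :=
  strong_rec 0 (fun k h => (k == 0%N)%:R - \sum_(a < k) sgn_e a.+1 * h (k - a.+1)%N).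

Lemma conv_sgn_e_h k : conv sgn_e hcoef k = (k == 0%N)%:R.
Proof.
rewrite /conv big_ord_recl /= subn0 {1}/sgn_e ecoef0 !mul1r.
rewrite {1}/hcoef strong_recE -/hcoef ?subrK // => f g fg.
by congr (_ - _); apply: eq_bigr => a _; rewrite fg //; have := ltn_ord a; lia.
Qed.

(* The coefficients of prod_(i <= j) (1 - w q^(i+j))^-1, through the functional equation
   C(q^2 w) = (w; q)_oo C(w). *)
Definition ccoef : nat -> K :=
  strong_rec 0 (fun M c => if M == 0%N then 1 else
    - (1 - q ^+ M.*2)^-1 * \sum_(s < M) sgn_e s.+1 * c (M - s.+1)%N).

Lemma ccoef0 : ccoef 0 = 1. Proof. by []. Qed.

(** The functional equation C(q^2 w) = (w; q)_oo C(w); the recursion defining [ccoef] is this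
    equation solved for its top coefficient. *)
Lemma conv_sgn_e_c M : conv sgn_e ccoef M = q ^+ M.*2 * ccoef M.
Proof.
rewrite /conv big_ord_recl /= subn0 {1}/sgn_e ecoef0 !mul1r.
have [->|M0] := posnP M; first by rewrite big_ord0 addr0 expr0 mul1r.
have cM : ccoef M = - (1 - q ^+ M.*2)^-1 *
    \sum_(s < M) sgn_e s.+1 * ccoef (M - s.+1)%N.
  rewrite {1}/ccoef strong_recE -/ccoef (gtn_eqF M0) // => f g fg.
  by congr (_ * _); apply: eq_bigr => a _; rewrite fg //; have := ltn_ord a; lia.
have nz : 1 - q ^+ M.*2 != 0 by rewrite one_sub_qX_neq0 // double_gt0.
rewrite /bump /= (eq_bigr (fun s : 'I_M => sgn_e s.+1 * ccoef (M - s.+1)%N)) //.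
have -> : \sum_(s < M) sgn_e s.+1 * ccoef (M - s.+1)%N = - (1 - q ^+ M.*2) * ccoef M.
  by rewrite cM; field.
by ring.
Qed.

(** The same functional equation divided by (w; q)_oo. *)
Lemma conv_h_c M : conv hcoef (fun s => q ^+ s.*2 * ccoef s) M = ccoef M.
Proof.
rewrite -[RHS]conv_delta -(eq_conv (fun k _ => conv_sgn_e_h k) (fun k _ => erefl _)).
transitivity (conv hcoef (conv sgn_e ccoef) M).
  by apply: eq_conv => // k _; rewrite conv_sgn_e_c.
by rewrite convA; apply: eq_conv => // k _; rewrite convC.
Qed.

(** C_M indexed by x = 2 M and extended by 0, so that x = n - |lambda| may be odd or negative. *)
Definition cx (x : int) : K :=
  if x is Posz m then if odd m then 0 else ccoef m./2 else 0.

Lemma cx_neg (x : int) : x < 0 -> cx x = 0. Proof. by case: x. Qed.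

Lemma cx_double M : cx M.*2%:Z = ccoef M.
Proof. by rewrite /= odd_double doubleK. Qed.

Lemma cx_odd (x : int) M : x = M.*2.+1%:Z -> cx x = 0.
Proof. by move=> ->; rewrite /= odd_double. Qed.

(** A dichotomy stable under subtracting even numbers, suited to sums over [x - s.*2]. *)
Variant cx_spec (x : int) : Prop :=
| CxZero of (forall s : nat, cx (x - s.*2%:Z) = 0)
| CxEven M of x = M.*2%:Z.

Lemma cxP x : cx_spec x.
Proof.
case: x => [m|m].
  have [om|em] := boolP (odd m).
    apply: CxZero => s; have [ls|ls] := leqP s.*2 m.
      by apply: (@cx_odd _ (m - s.*2)./2); have := odd_double_half (m - s.*2); rewrite oddB // odd_double om /=; lia.
    by rewrite cx_neg //; lia.
  by apply: (@CxEven _ m./2); rewrite even_halfK.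
by apply: CxZero => s; rewrite cx_neg //; lia.
Qed.

(* sum_(b, c) (-1)^b q^(b+c) e_b w^(b+c) = (q w; q)_oo / (1 - q w) = (q^2 w; q)_oo. *)
Lemma cx_two_sum (x : int) B : x <= B.*2%:Z ->
  \sum_(b < B.+1) \sum_(c < B.+1)
    sgn_e b * q ^+ (b + c) * (q ^ (x - (b + c).*2%:Z) * cx (x - (b + c).*2%:Z))
  = q ^ x * (q ^ x * cx x).
Proof.
case: (cxP x) => [x0 _|M -> MB].
  have := x0 0%N; rewrite subr0 => ->; rewrite !mulr0 big1 // => b _.
  by rewrite big1 // => c _; rewrite x0 !mulr0.
have {}MB : (M <= B)%N by lia.
pose G s : K := if (s <= M)%N then q ^+ (s + (M - s).*2) * ccoef (M - s) else 0.
have GE s : q ^+ s * (q ^ (M.*2%:Z - s.*2%:Z) * cx (M.*2%:Z - s.*2%:Z)) = G s.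
  rewrite /G; case: leqP => sM; last by rewrite cx_neg ?mulr0 //; lia.
  rewrite (_ : M.*2%:Z - s.*2%:Z = (M - s).*2%:Z); last by lia.
  by rewrite cx_double -exprnP exprD mulrA.
transitivity (\sum_(b < B.+1) \sum_(c < B.+1) sgn_e b * G (b + c)%N).
  by apply: eq_bigr => b _; apply: eq_bigr => c _; rewrite -GE mulrA.
rewrite sum_antidiagonal => [|s sB]; last first.
  by rewrite /G leqNgt (leq_ltn_trans MB).
(* The exponent s from the partial sum and s + 2 (M - s) from [G] add up to 2 M, leaving the
   functional equation of [ccoef]. *)
transitivity (q ^+ M.*2 * conv sgn_e ccoef M); last first.
  by rewrite conv_sgn_e_c cx_double -!exprnP.
rewrite mulr_sumr (big_ord_widen B.+1 (fun k => q ^+ M.*2 * (sgn_e k * ccoef (M - k)))) //.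
rewrite [RHS]big_mkcond; apply: eq_bigr => s _; rewrite ltnS /G.
case: leqP => sM; last by rewrite mul0r.
rewrite sum_sgn_e (_ : M.*2 = s + s + (M - s).*2)%N; last by lia.
by rewrite !exprD; ring.
Qed.

End QSeries.

(* In the coordinates p = lambda + rho, this is |lambda|. *)
Definition psize n (p : 'I_n -> int) : int := \sum_i p i - (\sum_(i < n) i.+1)%N%:Z.

Lemma sum_succ_ord n : (\sum_(i < n) i.+1 = \sum_(i < n) i + n)%N.
Proof.
under eq_bigr => i _ do rewrite -addn1.
by rewrite big_split sum1_card card_ord.
Qed.

Lemma double_sum_ord n : ((\sum_(i < n) i).*2 + n = n * n)%N.
Proof.
elim: n => [|n IHn]; first by rewrite big_ord0.
by rewrite big_ord_recr /= doubleD mulSn mulnS -IHn; move: (\sum_(i < n) i)%N => x; lia.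
Qed.

Lemma psizeD n (p c : 'I_n -> int) :
  psize (fun i => p i + c i) = psize p + \sum_i c i.
Proof. by rewrite /psize big_split /= addrAC. Qed.

Lemma psize_ge0 n (p : 'I_n -> int) : injective p -> (forall i, 0 < p i) -> 0 <= psize p.
Proof.
move=> p_inj p_pos; have p1 i : 1%N%:Z <= p i by have := p_pos i; lia.
have := sum_inj_pos_ge p_inj p1; rewrite /psize sum_succ_ord muln1 -PoszD.
by rewrite subr_ge0.
Qed.

(** * The determinants D built from e_k(1, q, q^2, ...) *)

Section Schur.
Variables (K : numFieldType) (q : K).
Hypothesis q_gt1 : 1 < q.
Local Notation e := (ecoef q).
Local Notation d := (dcoef q).
Local Notation D := (row_det (ecoef q)).

Lemma pieri_h n (p : 'I_n -> int) (B a : nat) :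
  (forall i, 0 < p i) -> psize p + a%:Z <= n%:Z -> (a <= B)%N ->
  \sum_(c : {ffun 'I_n -> 'I_B.+1} | (\sum_i c i == a)%N)
      D (fun i => p i + (c i)%:Z) = e a%:Z * D p.
Proof.
move=> p_pos le_n; apply: pieri_complete => //.
- exact: ecoef_neg.
- exact: ecoef0.
by move: le_n; rewrite /psize sum_succ_ord !PoszD addrAC lerBlDr addrCA addrC.
Qed.

Lemma pieri_e n (p : 'I_n -> int) (s : nat) :
  (forall i, 0 < p i) -> psize p + s%:Z <= n%:Z ->
  \sum_(S : {set 'I_n} | #|S| == s) D (fun i => p i + (i \in S)%:Z)
    = hcoef q s * D p.
Proof.
move=> p_pos le_n; apply: pieri_elementary => //.
- exact: ecoef_neg.
- exact: ecoef0.
- exact: conv_sgn_e_h.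
by move: le_n; rewrite /psize sum_succ_ord !PoszD addrAC lerBlDr addrCA addrC.
Qed.

Lemma prod_exprz (I : finType) (F : I -> int) : \prod_i q ^ F i = q ^ (\sum_i F i).
Proof.
apply/esym/(big_morph (fun k : int => q ^ k)) => [x y|]; last by rewrite expr0z.
by apply: expfzDr; rewrite q_neq0.
Qed.

(** In each term of the determinant the arguments of [f] add up to [psize p], whatever the
    permutation. *)
Lemma row_det_scale n (p : 'I_n -> int) (f : int -> K) (c : int) :
  row_det (fun k => q ^ (c * k) * f k) p = q ^ (c * psize p) * row_det f p.
Proof.
rewrite /row_det /determinant mulr_sumr; apply: eq_bigr => s _.
rewrite mulrCA; congr (_ * _); under eq_bigr => i _ do rewrite mxE.
rewrite big_split /= prod_exprz -mulr_sumr; congr (q ^ (c * _) * _).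
  rewrite !big_split /= sumr_const card_ord -mulr_natr /psize sum_succ_ord.
  have <- : \sum_(i < n) i%:Z = \sum_(i < n) (s i)%:Z.
    by rewrite [LHS](reindex_inj (@perm_inj _ s)).
  have := double_sum_ord n; rewrite -(big_morph Posz PoszD (erefl _)).
  move: (\sum_i p i) (\sum_(i < n) i)%N => x y; rewrite natz; lia.
by apply: eq_bigr => i _; rewrite mxE.
Qed.

Lemma det_dcoef n (p : 'I_n -> int) : row_det d p = q ^ psize p * D p.
Proof.
rewrite -[psize p]mul1r -row_det_scale; congr (\det _).
by apply/matrixP=> i j; rewrite !mxE mul1r.
Qed.

(* The row operation e_k + q^-1 e_(k-1) = q^-k e_k. *)
Lemma sum_remove_strip n (p : 'I_n -> int) :
  \sum_(S : {set 'I_n}) q ^- #|S| * D (fun i => p i - (i \in S)%:Z)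
    = q ^ (- psize p) * D p.
Proof.
transitivity (row_det (fun k => q ^ (-1 * k) * e k) p); last first.
  by rewrite row_det_scale mulN1r.
rewrite [RHS]/row_det /determinant.
(* Every entry is a sum of two terms; [S] records the rows in which the term with q^-1 is chosen. *)
under [RHS]eq_bigr => s _.
  under eq_bigr => i _ do rewrite mxE mulN1r -ecoef_qV // addrC.
  rewrite bigA_distr mulr_sumr; over.
rewrite exchange_big /=; apply: eq_bigr => S _.
rewrite /row_det /determinant mulr_sumr; apply: eq_bigr => s _.
rewrite mulrCA; congr (_ * _).
transitivity (\prod_i ((if i \in S then q^-1 else 1) * e (p i - (i \in S)%:Z - n%:Z + (s i)%:Z))).
  rewrite big_split /= -big_mkcond /= prodr_const exprVn; congr (_ * _).
  by apply: eq_bigr => i _; rewrite mxE.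
apply: eq_bigr => i _; case: ifP => iS; rewrite ?mul1r ?subr0 //.
by congr (_ * e _); lia.
Qed.

(** * Replacing the first column of D *)

Section FirstColumn.
Variables (n : nat) (p : 'I_n.+1 -> int).
Let M : 'M[K]_n.+1 := \matrix_(i, j) e (p i - n.+1%:Z + j%:Z).

(* The determinant defining [D p] with its first column replaced by [x]. *)
Definition det_col0 (x : 'I_n.+1 -> K) : K := \sum_i x i * cofactor M i ord0.

Lemma cofactor_col0 i : cofactor M i ord0 = (-1) ^+ i * D (fun a => p (lift i a)).
Proof.
rewrite /cofactor addn0; congr (_ * \det _); apply/matrixP=> a b; rewrite !mxE.
by congr e; rewrite lift0 -!addrA; congr (_ + _) => /=; lia.
Qed.

(** The new first column repeats column [j] unless [j] is 0; this is an entry of the adjugate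
    identity. *)
Lemma det_col0_ecoef (j : 'I_n.+1) :
  det_col0 (fun i => e (p i - n.+1%:Z + j%:Z)) = (j == ord0)%:R * D p.
Proof.
have := congr1 (fun A : 'M_n.+1 => A ord0 j) (mul_adj_mx M).
rewrite !mxE eq_sym => E; rewrite mulr_natl -[RHS]E; apply: eq_bigr => i _.
by rewrite !mxE mulrC.
Qed.

Lemma det_col0D x y : det_col0 (fun i => x i + y i) = det_col0 x + det_col0 y.
Proof. by rewrite -big_split; apply: eq_bigr => i _; rewrite mulrDl. Qed.

(** Starting from the column d_0, the relation e_j = d_j + d_(j-1) successively reduces the columns
    e_j to d_j, which gives [row_det d]. *)
Lemma det_col0_dcoef0 :
  det_col0 (fun i => d (p i - n.+1%:Z)) = q ^ psize p * D p.
Proof.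
pose A : 'M[K]_n.+1 :=
  \matrix_(i, j) if j == ord0 then d (p i - n.+1%:Z) else M i j.
transitivity (\det A).
  rewrite (expand_det_col _ ord0); apply: eq_bigr => i _; rewrite !mxE eqxx.
  congr (_ * _); rewrite /cofactor; congr (_ * \det _).
  by apply/matrixP=> a b; rewrite !mxE.
rewrite -det_dcoef /row_det; set B := \matrix_(i, j) _.
pose T : 'M[K]_n.+1 := \matrix_(i, j) ((i == j)%:R + (i.+1 == j :> nat)%:R).
have -> : A = B *m T.
  apply/matrixP=> i j; rewrite !mxE.
  under eq_bigr => k _ do rewrite !mxE mulrDr.
  rewrite big_split (bigD1 j) //= eqxx mulr1 big1 ?addr0; last first.
    by move=> k /negbTE ->; rewrite mulr0.
  case: (unliftP ord0 j) => [k|] -> /=; last first.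
    by rewrite big1 ?addr0 // => k _; rewrite mulr0.
  rewrite /bump leq0n add1n (bigD1 (widen_ord (leqnSn n) k)) //= eqxx mulr1 big1 ?addr0.
    by rewrite ecoefE //; congr (_ + d _); lia.
  by move=> t; rewrite -val_eqE /= eqSS => /negbTE ->; rewrite mulr0.
rewrite det_mulmx -(det_tr T); have -> : \det T^T = 1; last by rewrite mulr1.
apply: det_lower_unit => [i j ij|i]; rewrite !mxE.
  by rewrite -val_eqE /= gtn_eqF // gtn_eqF ?addr0 // ltnS ltnW.
by rewrite eqxx gtn_eqF // addr0.
Qed.

(* Modulo the other columns e_(k+j) = d_(k+j) + d_(k+j-1), the columns d alternate. *)
Lemma det_col0_dcoef (j : nat) : (j <= n.+1)%N ->
  det_col0 (fun i => d (p i - n.+1%:Z + j%:Z - 1)) =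
  (j == 0%N)%:R * D p - (-1) ^+ j * q ^ psize p * D p.
Proof.
have step (k : nat) : (k < n.+1)%N -> det_col0 (fun i => d (p i - n.+1%:Z + k%:Z - 1)) =
    (k == 0%N)%:R * D p - det_col0 (fun i => d (p i - n.+1%:Z + k%:Z)).
  move=> kn; apply/eqP; rewrite eq_sym subr_eq eq_sym addrC -det_col0D.
  rewrite -(det_col0_ecoef (Ordinal kn)); apply/eqP/eq_bigr => i _.
  by rewrite [in RHS]ecoefE.
elim: j => [_|j IHj jn].
  rewrite step // expr0 mul1r -det_col0_dcoef0; congr (_ - _).
  by apply: eq_bigr => i _; rewrite addr0.
have -> : det_col0 (fun i => d (p i - n.+1%:Z + j.+1%:Z - 1)) =
    (j == 0%N)%:R * D p - det_col0 (fun i => d (p i - n.+1%:Z + j%:Z - 1)).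
  rewrite (step j jn) opprB addrC subrK; apply: eq_bigr => i _.
  by congr (d _ * _); lia.
rewrite (IHj (ltnW jn)) exprS.
rewrite opprB addrC subrK.
rewrite mul0r add0r mulN1r !mulNr opprK.
reflexivity.
Qed.

End FirstColumn.

End Schur.

(** * The alternating sum *)

Lemma sum_pair_lift0 (V : nmodType) n (F : 'I_n.+1 * 'I_n.+1 -> V) :
  \sum_p F p = F (ord0, ord0) + \sum_j F (ord0, lift ord0 j)
    + (\sum_i F (lift ord0 i, ord0) + \sum_p F (lift ord0 p.1, lift ord0 p.2)).
Proof.
transitivity (\sum_i \sum_j F (i, j)).
  by rewrite pair_bigA; apply: eq_bigr => -[].
rewrite big_ord_recl [X in X + _]big_ord_recl; congr (_ + _).
under eq_bigr => i _ do rewrite big_ord_recl.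
by rewrite big_split /= (pair_bigA _ (fun i j => F (lift ord0 i, lift ord0 j))).
Qed.

Lemma sumn_pair_lift0 n (F : 'I_n.+1 * 'I_n.+1 -> nat) :
  (\sum_p F p = F (ord0, ord0) + \sum_j F (ord0, lift ord0 j)
    + (\sum_i F (lift ord0 i, ord0) + \sum_p F (lift ord0 p.1, lift ord0 p.2)))%N.
Proof. exact: sum_pair_lift0. Qed.

(** * The q-partition function, one variable at a time *)

Section BoxedPartitionFunction.
Variables (B : nat).

Definition root_mults n := ({ffun 'I_n * 'I_n -> 'I_B.+1} * {ffun 'I_n * 'I_n -> 'I_B.+1})%type.

Definition triangular n (ab : root_mults n) : bool :=
  [forall p : 'I_n * 'I_n, ~~ (p.1 < p.2)%N ==> (val (ab.1 p) == 0%N)] &&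
  [forall p : 'I_n * 'I_n, (p.2 < p.1)%N ==> (val (ab.2 p) == 0%N)].

Definition root_total n (ab : root_mults n) : nat :=
  (\sum_(p : 'I_n * 'I_n) val (ab.1 p) + \sum_(p : 'I_n * 'I_n) val (ab.2 p))%N.

Definition root_weight n (ab : root_mults n) (t : 'I_n) : int :=
  \sum_(p : 'I_n * 'I_n) (val (ab.1 p))%:Z * ((p.1 == t)%:Z - (p.2 == t)%:Z)
  - \sum_(p : 'I_n * 'I_n) (val (ab.2 p))%:Z * ((p.1 == t)%:Z + (p.2 == t)%:Z).

(** F_q evaluated at a ring element, with multiplicities at most [B] so that the sum is finite. Both
    'X and rational numbers are substituted for [q]. *)
Definition Fbox (R : comNzRingType) (q : R) n (beta : 'I_n -> int) : R :=
  \sum_(ab : root_mults n | triangular ab && [forall t, root_weight ab t == beta t])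
    q ^+ root_total ab.

(** Exponents of the factors containing the first variable: [d] for x_0/x_j, [g] for 1/(x_0 x_j) and
    [c] for 1/x_0^2. *)
Let row_data n := ({ffun 'I_n -> 'I_B.+1} * {ffun 'I_n -> 'I_B.+1} * 'I_B.+1)%type.

Let join n (x : row_data n * root_mults n) : root_mults n.+1 :=
  let: ((d, g, c), ab) := x in
  ([ffun p => match unlift ord0 p.1, unlift ord0 p.2 with
     | None, Some j => d j | Some i, Some j => ab.1 (i, j) | _, _ => ord0 end],
   [ffun p => match unlift ord0 p.1, unlift ord0 p.2 with
     | None, None => c | None, Some j => g j
     | Some i, Some j => ab.2 (i, j) | _, _ => ord0 end]).

Let split_row n (ab : root_mults n.+1) : row_data n * root_mults n :=
  ([ffun j => ab.1 (ord0, lift ord0 j)], [ffun j => ab.2 (ord0, lift ord0 j)],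
   ab.2 (ord0, ord0),
   ([ffun p => ab.1 (lift ord0 p.1, lift ord0 p.2)],
    [ffun p => ab.2 (lift ord0 p.1, lift ord0 p.2)])).

Let joinK n : cancel (@join n) (@split_row n).
Proof.
move=> [[[d g] c] [a b]]; rewrite /split_row /join /=.
by congr (_, _, _, (_, _)); [| |by rewrite ffunE /= unlift_none| |];
  apply/ffunP => x; rewrite !ffunE /= ?unlift_none ?liftK //; case: x.
Qed.

Let split_rowK n (ab : root_mults n.+1) : triangular ab -> join (split_row ab) = ab.
Proof.
case: ab => a b /andP[/forallP /= Ha /forallP /= Hb]; rewrite /join /split_row /=.
have a0 (p : 'I_n.+1 * 'I_n.+1) : ~~ (p.1 < p.2)%N -> a p = ord0.
  by move=> lt; apply: val_inj; apply/eqP; have := Ha p; rewrite lt.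
have b0 (p : 'I_n.+1 * 'I_n.+1) : (p.2 < p.1)%N -> b p = ord0.
  by move=> lt; apply: val_inj; apply/eqP; have := Hb p; rewrite lt.
congr (_, _); apply/ffunP => -[i j]; rewrite !ffunE /=.
  case: (unliftP ord0 i) => [i'|] ->; case: (unliftP ord0 j) => [j'|] ->; rewrite ?ffunE //=.
    by rewrite a0.
  by rewrite a0.
case: (unliftP ord0 i) => [i'|] ->; case: (unliftP ord0 j) => [j'|] ->; rewrite ?ffunE //=.
by rewrite b0.
Qed.

Let triangular_join n x : triangular (@join n x) = triangular x.2.
Proof.
case: x => [[[d g] c] [a b]]; rewrite /triangular /=.
congr (_ && _); apply/forallP/forallP => H p.
- by have := H (lift ord0 p.1, lift ord0 p.2); rewrite ffunE /= !liftK /bump !add1n ltnS; case: p.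
- case: p => i j; rewrite ffunE /=.
  case: (unliftP ord0 i) => [i'|] ->; case: (unliftP ord0 j) => [j'|] -> //=; rewrite ?implybT //.
  by have := H (i', j'); rewrite /bump !add1n ltnS.
- by have := H (lift ord0 p.1, lift ord0 p.2); rewrite ffunE /= !liftK /bump !add1n ltnS; case: p.
case: p => i j; rewrite ffunE /=.
case: (unliftP ord0 i) => [i'|] ->; case: (unliftP ord0 j) => [j'|] -> //=; rewrite ?implybT //.
by have := H (i', j'); rewrite /bump !add1n ltnS.
Qed.

Let total_join n (x : row_data n * root_mults n) :
  root_total (join x) = (\sum_j x.1.1.1 j + \sum_j x.1.1.2 j + x.1.2 + root_total x.2)%N.
Proof.
case: x => [[[d g] c] [a b]]; rewrite /root_total /= !sumn_pair_lift0 /=.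
rewrite !ffunE /= !unlift_none.
under eq_bigr => j _ do rewrite ffunE /= unlift_none liftK.
under [X in (_ + (X + _) + _)%N]eq_bigr => j _ do rewrite ffunE /= unlift_none liftK.
under [X in (_ + (_ + X) + _)%N]eq_bigr => j _ do rewrite ffunE /= !liftK -surjective_pairing.
under [X in (_ + (_ + X + _))%N]eq_bigr => j _ do rewrite ffunE /= unlift_none liftK.
under [X in (_ + (_ + (X + _)))%N]eq_bigr => j _ do rewrite ffunE /= unlift_none liftK.
under [X in (_ + (_ + (_ + X)))%N]eq_bigr => j _ do rewrite ffunE /= !liftK -surjective_pairing.
rewrite !big1_eq /= !add0n; move: (\sum_j d j)%N => x.
rewrite [(c + _)%N]addnC -!addnA; congr (_ + _)%N; rewrite addnCA; congr (_ + _)%N.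
by rewrite addnCA.
Qed.

Let weight_join0 n (x : row_data n * root_mults n) :
  root_weight (join x) ord0 =
  (\sum_j x.1.1.1 j)%N%:Z - (\sum_j x.1.1.2 j)%N%:Z - (x.1.2 : nat).*2%:Z.
Proof.
case: x => [[[d g] c] [a b]]; rewrite /root_weight /= !sum_pair_lift0 /=.
rewrite !ffunE /= !unlift_none /=.
under eq_bigr => j _ do rewrite ffunE /= unlift_none liftK /= mulr1.
under [X in (_ + (X + _) - _)]eq_bigr => j _ do rewrite ffunE /= unlift_none liftK mul0r.
under [X in (_ + (_ + X) - _)]eq_bigr => j _ do rewrite subrr mulr0.
under [X in (_ - (_ + X + _))]eq_bigr => j _ do rewrite ffunE /= unlift_none liftK /= mulr1.
under [X in (_ - (_ + (X + _)))]eq_bigr => j _ do rewrite ffunE /= unlift_none liftK mul0r.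
under [X in (_ - (_ + (_ + X)))]eq_bigr => j _ do rewrite addr0 mulr0.
rewrite !big1_eq /= -!(big_morph Posz PoszD (erefl _)).
move: (\sum_j d j)%N (\sum_j g j)%N => u v; lia.
Qed.

Let weight_joinS n (x : row_data n * root_mults n) t :
  root_weight (join x) (lift ord0 t) =
  root_weight x.2 t - (x.1.1.1 t)%:Z - (x.1.1.2 t)%:Z.
Proof.
have delta (f : 'I_n -> nat) : \sum_j (f j)%:Z * (j == t)%:Z = f t.
  rewrite (bigD1 t) //= eqxx mulr1 big1 ?addr0 // => j /negbTE ->.
  by rewrite mulr0.
case: x => [[[d g] c] [a b]]; rewrite /root_weight /= !sum_pair_lift0 /=.
rewrite !ffunE /= !unlift_none /=. rewrite mul0r mulr0 !add0r.
have liftE (i : 'I_n) : (lift ord0 i == lift ord0 t) = (i == t) by rewrite (inj_eq lift_inj).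
under eq_bigr => j _ do rewrite ffunE /= unlift_none liftK /= liftE sub0r mulrN.
rewrite sumrN delta.
under [X in (_ + (X + _) - _)]eq_bigr => j _ do rewrite ffunE /= unlift_none liftK mul0r.
under [X in (_ + (_ + X) - _)]eq_bigr => j _ do rewrite ffunE /= !liftK -surjective_pairing !liftE.
under [X in (_ - (X + _))]eq_bigr => j _ do rewrite ffunE /= unlift_none liftK /= liftE add0r.
rewrite delta.
under [X in (_ - (_ + (X + _)))]eq_bigr => j _ do rewrite ffunE /= unlift_none liftK mul0r.
under [X in (_ - (_ + (_ + X)))]eq_bigr => j _ do rewrite ffunE /= !liftK -surjective_pairing !liftE.
by rewrite !big1_eq !add0r opprD addrACA addrC addrA.
Qed.

(** The factors with the first variable must produce its whole exponent. They contribute - d_j - g_j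
    to that of x_j, which the remaining factors compensate. *)
Lemma Fbox_rec (R : comNzRingType) (q : R) n (beta : 'I_n.+1 -> int) :
  Fbox q beta = \sum_(d : {ffun 'I_n -> 'I_B.+1}) \sum_(g : {ffun 'I_n -> 'I_B.+1})
    \sum_(c < B.+1 | (\sum_j d j)%N%:Z - (\sum_j g j)%N%:Z - c.*2%:Z == beta ord0)
      q ^+ (\sum_j d j + \sum_j g j + c)
      * Fbox q (fun t => beta (lift ord0 t) + (d t)%:Z + (g t)%:Z).
Proof.
rewrite pair_bigA pair_big_dep /=.
under eq_bigr => x _ do rewrite /Fbox mulr_sumr.
rewrite pair_big_dep /= /Fbox (reindex_onto (@join n) (@split_row n)); last first.
  by move=> ab /andP[tri _]; rewrite split_rowK.
apply: eq_big => x.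
  rewrite joinK eqxx andbT triangular_join andbCA; congr (_ && _).
  apply/forallP/andP => [Hw|[/eqP w0 /forallP Hw] t].
    split; first by rewrite -weight_join0 Hw.
    apply/forallP => t; have /eqP := Hw (lift ord0 t); rewrite weight_joinS => <-.
    by apply/eqP; ring.
  case: (unliftP ord0 t) => [t'|] ->; last by rewrite weight_join0 w0.
  rewrite weight_joinS (eqP (Hw t')); apply/eqP; ring.
by move=> _; rewrite total_join exprD.
Qed.

End BoxedPartitionFunction.

Lemma sum_perm_lift0 (V : nmodType) n (F : 'S_n.+1 -> V) :
  \sum_s F s = \sum_i \sum_(s : 'S_n) F (lift_perm ord0 i s).
Proof.
rewrite pair_bigA (reindex (fun x : 'I_n.+1 * 'S_n => lift_perm ord0 x.1 x.2)) //=.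
apply: onW_bij; apply: inj_card_bij => [[i s] [j t] /= /permP E|]; last first.
  by rewrite card_prod card_ord !card_Sn factS.
have ij : i = j by have := E ord0; rewrite !lift_perm_id.
congr (_, _) => //; apply/permP => k; have := E (lift ord0 k).
by rewrite !lift_perm_lift -ij => /lift_inj.
Qed.

Arguments ecoef : simpl never.

(* U_(p - rho, (1^n)) at q, with all multiplicities truncated at B. *)
Section Ubox.
Variables (B : nat) (R : comNzRingType) (q : R).

Lemma eq_Fbox n (b b' : 'I_n -> int) : b =1 b' -> Fbox B q b = Fbox B q b'.
Proof.
move=> E; apply: eq_bigl => ab; congr (_ && _).
by apply: eq_forallb => t; rewrite E.
Qed.

Definition Ubox n (p : 'I_n -> int) : R :=
  \sum_(s : 'S_n) (-1) ^+ odd_perm s * Fbox B q (fun i => p (s i) - 1 - rho i).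

Lemma eq_Ubox n (p p' : 'I_n -> int) : p =1 p' -> Ubox p = Ubox p'.
Proof.
by move=> E; apply: eq_bigr => s _; congr (_ * _); apply: eq_Fbox => i; rewrite E.
Qed.

Lemma Ubox_perm n (p : 'I_n -> int) (t : 'S_n) :
  Ubox (fun i => p (t i)) = (-1) ^+ odd_perm t * Ubox p.
Proof.
rewrite /Ubox [in RHS](reindex_inj (mulIg t)) mulr_sumr /=; apply: eq_bigr => s _.
have -> : (-1) ^+ odd_perm s = (-1) ^+ odd_perm t * (-1) ^+ odd_perm (s * t)%g :> R.
  by rewrite odd_permM -signr_addb addbC addbK.
by rewrite mulrA; congr (_ * _); apply: eq_Fbox => i; rewrite permM.
Qed.

(** Permutations are split by the index [i] of the entry placed first, at the cost of the sign
    (-1)^i; then the first variable is expanded. *)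
Lemma Ubox_rec n (p : 'I_n.+1 -> int) :
  Ubox p = \sum_(i < n.+1) (-1) ^+ i *
    \sum_(d : {ffun 'I_n -> 'I_B.+1}) \sum_(g : {ffun 'I_n -> 'I_B.+1})
    \sum_(c < B.+1 | (\sum_j d j)%N%:Z - (\sum_j g j)%N%:Z - c.*2%:Z
        == p i - 1 - n.+1%:Z)
      q ^+ (\sum_j d j + \sum_j g j + c)
      * Ubox (fun t : 'I_n => p (lift i t) + (d t)%:Z + (g t)%:Z).
Proof.
rewrite /Ubox sum_perm_lift0; apply: eq_bigr => i _.
transitivity (\sum_(s : 'S_n) (-1) ^+ i * ((-1) ^+ odd_perm s *
    \sum_(d : {ffun 'I_n -> 'I_B.+1}) \sum_(g : {ffun 'I_n -> 'I_B.+1})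
    \sum_(c < B.+1 | (\sum_j d j)%N%:Z - (\sum_j g j)%N%:Z - c.*2%:Z
        == p i - 1 - n.+1%:Z)
      q ^+ (\sum_j d j + \sum_j g j + c)
      * Fbox B q (fun t => p (lift i (s t)) + (d (s t))%:Z + (g (s t))%:Z - 1 - rho t))).
  apply: eq_bigr => s _; rewrite odd_lift_perm signr_addb addFb signr_odd -mulrA.
  congr (_ * (_ * _)); rewrite Fbox_rec.
  (* Relabelling by [s] attaches the shifts to the entries of [p] instead of their positions, so
     that they become independent of [s]. *)
  pose h (d : {ffun 'I_n -> 'I_B.+1}) := [ffun t => d (s t)].
  have h_inj : injective h.
    move=> d d' E; apply/ffunP => t; have := congr1 (fun f : {ffun 'I_n -> 'I_B.+1} => f ((s^-1)%g t)) E.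
    by rewrite !ffunE permKV.
  have sum_h d : (\sum_j h d j = \sum_j d j)%N.
    rewrite [RHS](reindex_inj (@perm_inj _ s)) /=.
    by apply: eq_bigr => j _; rewrite ffunE.
  rewrite (reindex_inj h_inj); apply: eq_bigr => d _.
  rewrite (reindex_inj h_inj); apply: eq_bigr => g _.
  rewrite !sum_h; apply: eq_big => c; first by rewrite lift_perm_id.
  move=> _; congr (_ * _); apply: eq_Fbox => t.
  rewrite lift_perm_lift !ffunE /rho lift0 subSS; ring.
rewrite -mulr_sumr; congr (_ * _).
under eq_bigr => s _ do rewrite mulr_sumr.
rewrite exchange_big /=; apply: eq_bigr => d _.
under eq_bigr => s _ do rewrite mulr_sumr.
rewrite exchange_big /=; apply: eq_bigr => g _.
under eq_bigr => s _ do rewrite mulr_sumr.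
rewrite exchange_big /=; apply: eq_bigr => c _.
rewrite mulr_sumr; apply: eq_bigr => s _.
by rewrite mulrCA.
Qed.

Lemma Ubox0 (p : 'I_0 -> int) : Ubox p = 1.
Proof.
have I0 (T : finType) : ('I_0 * T -> False) by case; case.
rewrite /Ubox (big_pred1 1%g) => [|s]; last by apply/esym/eqP/permP => -[].
rewrite odd_perm1 expr0 mul1r /Fbox.
pose z : {ffun 'I_0 * 'I_0 -> 'I_B.+1} := [ffun=> ord0].
rewrite (big_pred1 (z, z)) => [|ab].
  by rewrite /root_total !big1 // => p' _; rewrite ffunE.
have -> : ab = (z, z).
  by case: ab => a b; congr (_, _); apply/ffunP => x; case: (I0 _ x).
rewrite /= eqxx; apply/andP; split; last by apply/forallP => -[].
by apply/andP; split; apply/forallP => x; case: (I0 _ x).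
Qed.

End Ubox.

Lemma sum_by_total (V : nmodType) (I : finType) B (G : {ffun I -> 'I_B.+1} -> V) :
  (forall d : {ffun I -> 'I_B.+1}, (B < \sum_i d i)%N -> G d = 0) ->
  \sum_d G d = \sum_(a < B.+1) \sum_(d : {ffun I -> 'I_B.+1} | (\sum_i d i == a)%N) G d.
Proof.
move=> G0; rewrite (exchange_big_dep xpredT) //=; apply: eq_bigr => d _.
have [dB|dB] := leqP (\sum_i d i)%N B.
  rewrite [RHS](big_pred1 (Ordinal (dB : (\sum_i d i)%N < B.+1)%N)) => [//|a].
  by rewrite /= -val_eqE /= eq_sym.
rewrite G0 // big1 //.
Qed.

(** * The closed form of U *)

Section UboxClosed.
Variables (K : numFieldType) (q : K).
Hypothesis q_gt1 : 1 < q.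
Local Notation e := (ecoef q).
Local Notation D := (row_det (ecoef q)).

Lemma Ubox_alt B n (p : 'I_n -> int) i j : i != j -> p i = p j -> Ubox B q p = 0.
Proof.
move=> ne E; apply: eq_oppr0.
rewrite -mulN1r -[-1]expr1 -[1%N]/(nat_of_bool true) -ne -odd_tperm -Ubox_perm.
by apply: eq_Ubox => t; case: tpermP => [->|->|].
Qed.

(** For x = 2 M this is q^(2 M) C_M, a coefficient of C(q^2 w). *)
Definition ux (x : int) : K := q ^ x * cx q x.

Lemma ux_neg x : x < 0 -> ux x = 0.
Proof. by move=> x0; rewrite /ux cx_neg ?mulr0. Qed.

(** The Pieri rule used twice. The vanishing of [F] for a + b > x keeps only shifts whose sizes stay
    at most [n]. *)
Lemma sum_Pieri B n (p : 'I_n -> int) (x : int) (F : nat -> nat -> K) :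
  (forall i, 0 < p i) -> psize p + x <= n%:Z -> x <= B%:Z ->
  (forall a b, x < (a + b)%N%:Z -> F a b = 0) ->
  \sum_(d : {ffun 'I_n -> 'I_B.+1}) \sum_(g : {ffun 'I_n -> 'I_B.+1})
     F (\sum_j d j)%N (\sum_j g j)%N * D (fun t => p t + (d t)%:Z + (g t)%:Z)
  = \sum_(a < B.+1) \sum_(b < B.+1) F a b * (e a%:Z * e b%:Z) * D p.
Proof.
move=> p_pos px xB F0.
rewrite sum_by_total; last first.
  move=> d dB; rewrite big1 // => g _; rewrite F0 ?mul0r //.
  by apply: le_lt_trans xB _; rewrite ltz_nat (leq_trans dB) // leq_addr.
apply: eq_bigr => a _.
transitivity (\sum_(d : {ffun 'I_n -> 'I_B.+1} | (\sum_i d i == a)%N)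
    \sum_(b < B.+1) F a b * (e b%:Z * D (fun t => p t + (d t)%:Z))).
  apply: eq_bigr => d /eqP da; rewrite sum_by_total; last first.
    move=> g gB; rewrite F0 ?mul0r //.
    by apply: le_lt_trans xB _; rewrite ltz_nat (leq_trans gB) // leq_addl.
  apply: eq_bigr => b _.
  transitivity (\sum_(g : {ffun 'I_n -> 'I_B.+1} | (\sum_i g i == b)%N)
     F a b * D (fun t => p t + (d t)%:Z + (g t)%:Z)).
    by apply: eq_bigr => g /eqP ->; rewrite da.
  rewrite -mulr_sumr; have [ab|ab] := lerP (a + b)%N%:Z x; last by rewrite F0 // !mul0r.
  rewrite pieri_h //.
  - by move=> i; have := p_pos i; lia.
  - rewrite psizeD -(big_morph Posz PoszD (erefl _)) da; lia.
  - by rewrite -ltnS.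
rewrite exchange_big /=; apply: eq_bigr => b _.
rewrite -!mulr_sumr; have [ab|ab] := lerP (a + b)%N%:Z x; last by rewrite F0 // !mul0r.
rewrite pieri_h //; first by move: (F a b) (e a%:Z) (e b%:Z) (D p) => f u v y; ring.
- lia.
- by rewrite -ltnS.
Qed.

Lemma psize_lift n (p : 'I_n.+1 -> int) (i : 'I_n.+1) :
  psize p = psize (fun t : 'I_n => p (lift i t)) + p i - n.+1%:Z.
Proof.
rewrite /psize (bigD1_ord i) //= big_ord_recr /= PoszD.
move: (\sum_(i0 < n) p _) (\sum_(i0 < n) _)%N => x y; lia.
Qed.

(** A crude bound that needs no distinctness; it makes a box of side n^2 sufficient. *)
Lemma psize_pos_ge n (p : 'I_n -> int) : (forall i, 0 < p i) ->
  n%:Z - (n * n)%N%:Z <= psize p.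
Proof.
move=> p_pos; have : n%:Z <= \sum_i p i.
  rewrite -[n in n%:Z]card_ord -sum1_card (big_morph Posz PoszD (erefl _)).
  by apply: ler_sum => i _; have := p_pos i; lia.
have := double_sum_ord n; rewrite /psize sum_succ_ord.
move: (\sum_i p i) (\sum_(i0 < n) _)%N => x y; lia.
Qed.

(** Induction through [Ubox_rec]: the Pieri rule sums out [d] and [g], and the sum over [i] becomes
    the expansion of a determinant along a new first column. *)
Lemma Ubox_closed B n (p : 'I_n -> int) : (n * n <= B)%N -> (forall i, 0 < p i) ->
  Ubox B q p = qfact q n * ux (n%:Z - psize p) * D p.
Proof.
elim: n p => [|n IHn] p nB p_pos.
  rewrite Ubox0 /qfact big_ord0 /row_det det_mx00 mulr1 mul1r.
  by rewrite /psize !big_ord0 /ux (cx_double q 0) ccoef0 mulr1.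
have [p_inj|[i [j [ne pij]]]] := nat_injective_dec p; last first.
  by rewrite (Ubox_alt _ ne pij) (row_det_alt _ ne pij) mulr0.
pose x : int := n.+1%:Z - psize p; rewrite -/x.
have xB : x <= n.+1%:Z by have := psize_ge0 p_inj p_pos; rewrite /x; lia.
(* The exponent required of the first variable when entry [i] is placed first. *)
pose k i : int := p i - 1 - n.+1%:Z.
have xk (i : 'I_n.+1) : n%:Z - psize (fun t : 'I_n => p (lift i t)) = x + k i.
  by rewrite /x (psize_lift p i) /k; lia.
have kB i : x + k i <= B%:Z.
  rewrite -xk; have := @psize_pos_ge n (fun t : 'I_n => p (lift i t)) (fun t => p_pos _).
  by move: nB; rewrite mulSn mulnS; lia.
(* With [b] the total of [g], the total of [d] is forced to be a = k i + b + 2 c. Then q^(a+b+c) e_a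
   = q^(b+c) d_a and the argument of [ux] is x - 2 (b + c), so [w] does not depend on [i]. *)
pose w (b c : nat) : K := e b%:Z * q ^+ (b + c) * ux (x - (b + c).*2%:Z).
have w0 b c : x < (b + c).*2%:Z -> w b c = 0.
  by move=> xbc; rewrite /w ux_neg ?mulr0 //; lia.
transitivity (qfact q n * det_col0 q p (fun i => \sum_(b < B.+1) \sum_(c < B.+1)
    w b c * dcoef q (p i - n.+1%:Z + (b + c.*2)%N%:Z - 1))).
  rewrite Ubox_rec /det_col0 mulr_sumr; apply: eq_bigr => i _.
  rewrite cofactor_col0; pose S := \sum_(b < B.+1) \sum_(c < B.+1)
    w b c * dcoef q (p i - n.+1%:Z + (b + c.*2)%N%:Z - 1).
  rewrite -/S; have [Di DiE] : exists y, y = D (fun t : 'I_n => p (lift i t)) by eexists.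
  rewrite -DiE.
  transitivity ((-1) ^+ i * (qfact q n * S * Di)); last first.
    by clear DiE; move: (qfact q n) S Di ((-1) ^+ i) => a b c y; ring.
  congr (_ * _).
  pose F (a b : nat) : K := \sum_(c < B.+1 | a%:Z - b%:Z - c.*2%:Z == k i)
    q ^+ (a + b + c) * (qfact q n * ux (x + k i - (a + b)%N%:Z)).
  transitivity (\sum_(d : {ffun 'I_n -> 'I_B.+1}) \sum_(g : {ffun 'I_n -> 'I_B.+1})
     F (\sum_j d j)%N (\sum_j g j)%N * D (fun t : 'I_n => p (lift i t) + (d t)%:Z + (g t)%:Z)).
    apply: eq_bigr => d _; apply: eq_bigr => g _; rewrite /F mulr_suml.
    apply: eq_bigr => c _; rewrite IHn; last first.
    - by move=> t; have := p_pos (lift i t); lia.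
    - by move: nB; rewrite mulSn mulnS; lia.
    have -> : n%:Z - psize (fun t : 'I_n => p (lift i t) + (d t)%:Z + (g t)%:Z)
        = x + k i - (\sum_j d j + \sum_j g j)%N%:Z.
      rewrite -xk !psizeD PoszD !(big_morph Posz PoszD (erefl _)).
      by move: (psize _) (\sum_j (d j)%:Z) (\sum_j (g j)%:Z) => *; ring.
    exact: mulrA.
  rewrite (@sum_Pieri B n _ (x + k i)); first last.
  - by move=> a b ab; rewrite /F big1 // => c _; rewrite ux_neg ?mulr0 //; lia.
  - exact: kB.
  - by rewrite -xk; lia.
  - by move=> t; apply: p_pos.
  rewrite -DiE exchange_big /= [qfact q n * S]mulr_sumr [RHS]mulr_suml; apply: eq_bigr => b _.
  transitivity (\sum_(a < B.+1) \sum_(c < B.+1 | a%:Z == k i + b%:Z + c.*2%:Z)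
     qfact q n * w b c * dcoef q (k i + b%:Z + c.*2%:Z) * Di).
    apply: eq_bigr => a _; rewrite /F !mulr_suml; apply: eq_big => c.
      by apply/eqP/eqP; lia.
    move=> /eqP ac; have {}ac : a%:Z = k i + b%:Z + c.*2%:Z by lia.
    rewrite -ac dcoefE /w.
    rewrite (_ : x + k i - (a + b)%N%:Z = x - (b + c).*2%:Z); last by lia.
    rewrite -exprnP !exprD.
    clear DiE; move: (qfact q n) (ux _) (e a%:Z) (e b%:Z) (q ^+ a) (q ^+ b) (q ^+ c) Di => *; ring.
  rewrite (exchange_big_dep xpredT) //= [in RHS]mulr_sumr [RHS]mulr_suml; apply: eq_bigr => c _.
  rewrite (_ : p i - n.+1%:Z + (b + c.*2)%N%:Z - 1 = k i + b%:Z + c.*2%:Z); last first.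
    by rewrite /k; lia.
  (* The forced total may fall outside the box: below 0 the column entry vanishes, above [B] the
     weight [w] does. *)
  have [neg|nneg] := ltrP (k i + b%:Z + c.*2%:Z) 0.
    by rewrite dcoefE ecoef_neg // !mulr0 !mul0r big1.
  have [big|le_B] := ltrP B%:Z (k i + b%:Z + c.*2%:Z).
    rewrite w0; last by have := kB i; lia.
    by rewrite !(mul0r, mulr0) big1 // => a _; rewrite !(mul0r, mulr0).
  have aB : (absz (k i + b%:Z + c.*2%:Z)%R < B.+1)%N by lia.
  rewrite (big_pred1 (Ordinal aB)) => [|a]; first by rewrite mulrA.
  by rewrite /= -val_eqE /=; apply/eqP/eqP; lia.
  exact: q_gt1.
transitivity (qfact q n * \sum_(b < B.+1) \sum_(c < B.+1)
    w b c * (((b + c.*2)%N == 0%N)%:R * D p - (-1) ^+ (b + c.*2) * q ^ psize p * D p)).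
  congr (_ * _); rewrite /det_col0.
  under eq_bigr => i _ do rewrite mulr_suml.
  rewrite exchange_big /=; apply: eq_bigr => b _.
  under eq_bigr => i _ do rewrite mulr_suml.
  rewrite exchange_big /=; apply: eq_bigr => c _.
  (* Where [w] is nonzero, b + 2 c is at most x, hence at most n + 1, the range of
     [det_col0_dcoef]. *)
  have [bc|bc] := ltrP x (b + c).*2%:Z.
    by rewrite w0 // mul0r big1 // => i _; rewrite !mul0r.
  rewrite -det_col0_dcoef //; last by lia.
  by rewrite mulr_sumr; apply: eq_bigr => i _; rewrite mulrA.
transitivity (qfact q n * ((1 - q ^+ n.+1) * ux x * D p)); last first.
  by rewrite qfactS; move: (qfact q n) (1 - _) (ux x) (D p) => *; ring.
congr (_ * _).
(* The alternating part of the column sums to q^x [ux x], and the exceptional term b = c = 0 gives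
   [ux x]. *)
have two := @cx_two_sum _ _ q_gt1 x B.
have sumS : \sum_(b < B.+1) \sum_(c < B.+1) w b c * (-1) ^+ (b + c.*2) = q ^ x * ux x.
  rewrite -two; last by lia.
  apply: eq_bigr => b _; apply: eq_bigr => c _; rewrite /w /sgn_e /ux.
  have -> : (-1) ^+ (b + c.*2) = (-1) ^+ b :> K.
    by rewrite -signr_odd oddD odd_double addbF signr_odd.
  by move: (e b%:Z) ((-1) ^+ b) (_ * cx _ _) (q ^+ _) => *; ring.
have sum0 : \sum_(b < B.+1) \sum_(c < B.+1) w b c * ((b + c.*2)%N == 0%N)%:R = ux x.
  rewrite big_ord_recl [X in _ + X]big1 ?addr0 => [|b _]; last first.
    by rewrite big1 // => c _; rewrite mulr0.
  rewrite big_ord_recl [X in _ + X]big1 ?addr0 => [|c _]; last by rewrite mulr0.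
  by rewrite mulr1 /w ecoef0 !mul1r subr0.
transitivity (ux x * D p - q ^ x * ux x * q ^ psize p * D p).
  rewrite -sumS -{1}sum0 !mulr_suml -sumrB; apply: eq_bigr => b _.
  rewrite !mulr_suml -sumrB; apply: eq_bigr => c _.
  move: (w b c) (D p) (q ^ psize p) ((-1) ^+ _) (_%:R) => *; ring.
have -> : q ^+ n.+1 = q ^ x * q ^ psize p.
  by rewrite -expfzDr ?q_neq0 // /x subrK.
by move: (ux x) (D p) (q ^ psize p) (q ^ x) => *; ring.
Qed.

End UboxClosed.

(** * Words and blocks *)

Section Letters.
Variable n : nat.

Lemma letter_rank_lt (y : letter n) : (letter_rank y < 2 * n)%N.
Proof. by case: y => i /=; have := ltn_ord i; lia. Qed.

Lemma letter_rank_inj : injective (@letter_rank n).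
Proof.
by move=> [i|i] [j|j] /= E; [congr inl| | |congr inr];
  try apply: val_inj => /=; have := ltn_ord i; have := ltn_ord j; lia.
Qed.

Lemma letter_rankP r : (r < 2 * n)%N -> exists y : letter n, letter_rank y = r.
Proof.
move=> rn; have [lt|ge] := ltnP r n; first by exists (inl (Ordinal lt)).
have lt : (2 * n - 1 - r < n)%N by lia.
by exists (inr (Ordinal lt)) => /=; lia.
Qed.

Definition lw (y : letter n) : {ffun 'I_n -> int} := [ffun t => letter_wt y t].

End Letters.

Section Words.
Variables (n : nat) (R : comNzRingType) (q : R).
Local Notation V := {ffun 'I_n -> int}.
Variable ch : pred V.

(* Words of length m leading from p to l inside ch, weighted by the energy, with m added
   to the exponent when the first letter has rank below r. *)
Fixpoint word_sum (l : V) (m r : nat) (p : V) : R :=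
  if m is m'.+1 then
    \sum_(y : letter n | ch (p + lw y))
       q ^+ (m * (letter_rank y < r)%N) * word_sum l m' (letter_rank y).+1 (p + lw y)
  else (p == l)%:R.

(* [phi] is read as the power series sum_m u^m phi_m; [block phi k] applies to it the
   product over the letters y of rank at least 2 n - k, by increasing rank, of
   1 + u * (shift by y), keeping only the steps that stay in ch. *)
Fixpoint block (phi : nat -> V -> R) (k m : nat) (p : V) : R :=
  if k is k'.+1 then
    block phi k' m p +
    \sum_(y : letter n | letter_rank y == (2 * n - k)%N)
      (if m is m'.+1 then
         if ch (p + lw y) then block phi k' m' (p + lw y) else 0
       else 0)
  else phi m p.

End Words.

(** * The functional equation of the words *)

Section WordRecursion.
Variables (n : nat) (K : numFieldType) (q : K).
Hypothesis q_gt1 : 1 < q.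
Local Notation V := {ffun 'I_n -> int}.
Variable ch : pred V.
Local Notation word_sum := (word_sum q ch).
Local Notation block := (block ch).

(** The substitution of q u for u. *)
Definition dilate (phi : nat -> V -> K) m p : K := q ^+ m * phi m p.
Definition norm_words (l : V) m p : K := word_sum l m 0 p / qfact q m.

(* Words without any descent bonus on the first block form a block: T(u) = A(u) T(q u). *)
Lemma block_words l k m p : (k <= 2 * n)%N ->
  block (dilate (norm_words l)) k m p = word_sum l m (2 * n - k) p / qfact q m.
Proof.
elim: m k p => [|m IHm] k p.
  elim: k => [|k IHk] kn /=; first by rewrite /dilate /norm_words expr0 mul1r.
  by rewrite IHk 1?ltnW // big1 ?addr0.
elim: k => [_|k IHk kn].
  rewrite subn0 /= /dilate /norm_words mulrA; congr (_ / _).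
  rewrite /= mulr_sumr; apply: eq_bigr => y _.
  by rewrite letter_rank_lt muln1 muln0 mul1r.
have kr : (2 * n - k.+1 < 2 * n)%N by lia.
have [y yk] := letter_rankP kr.
have yE z : (letter_rank z == (2 * n - k.+1)%N) = (z == y).
  by rewrite -yk (inj_eq (@letter_rank_inj n)).
rewrite [LHS]/= IHk 1?ltnW // (eq_bigl _ _ yE) big_pred1_eq.
(* Lowering the threshold by one affects only words beginning with [y], whose factor q^(m+1) becomes
   1. The difference 1 - q^(m+1) cancels the last factor of [qfact q m.+1]. *)
have split_y r : word_sum l m.+1 r p =
    \sum_(z | ch (p + lw z) && (z != y)) q ^+ (m.+1 * (letter_rank z < r)%N) *
       word_sum l m (letter_rank z).+1 (p + lw z)
    + if ch (p + lw y) then q ^+ (m.+1 * (letter_rank y < r)%N) *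
       word_sum l m (letter_rank y).+1 (p + lw y) else 0.
  rewrite /= (bigID (fun z => z == y)) /= addrC; congr (_ + _).
  by rewrite big_mkcondl big_pred1_eq.
rewrite !split_y.
have -> : \sum_(z | ch (p + lw z) && (z != y)) q ^+ (m.+1 * (letter_rank z < 2 * n - k)%N) *
       word_sum l m (letter_rank z).+1 (p + lw z) =
   \sum_(z | ch (p + lw z) && (z != y)) q ^+ (m.+1 * (letter_rank z < 2 * n - k.+1)%N) *
       word_sum l m (letter_rank z).+1 (p + lw z).
  apply: eq_bigr => z /andP[_ zy].
  have ne : letter_rank z <> (2 * n - k.+1)%N by apply/eqP; rewrite yE.
  have -> // : (letter_rank z < 2 * n - k)%N = (letter_rank z < 2 * n - k.+1)%N.
  by apply/idP/idP; lia.
rewrite yk ltnn muln0 mul1r (_ : (2 * n - k.+1 < 2 * n - k)%N = true); last by lia.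
rewrite muln1 (_ : (2 * n - k.+1).+1 = 2 * n - k)%N; last by lia.
case: ifP => _; last by rewrite !addr0.
rewrite IHm 1?ltnW // qfactS.
move: (\sum_(z | _) _) (word_sum _ _ _ _) (qfact_neq0 q_gt1 m) (one_sub_qX_neq0 q_gt1 (ltn0Sn m)).
move: (qfact q m) (q ^+ m.+1) => a b u w a0 b0; field.
by rewrite a0 b0.
Qed.

Definition fixed_by_block (N : nat) (phi : nat -> V -> K) :=
  forall m p, (m <= N)%N -> ch p -> phi m p = block (dilate phi) (2 * n) m p.

Lemma norm_words_fixed N l : fixed_by_block N (norm_words l).
Proof. by move=> m p _ _; rewrite block_words // subnn. Qed.

(** In degree [m] a block reproduces [phi m] once; everything else it adds comes from lower
    degrees. *)
Lemma block_sub_head (phi psi : nat -> V -> K) k m p :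
  (forall m' p', (m' < m)%N -> ch p' -> phi m' p' = psi m' p') ->
  block phi k m p - phi m p = block psi k m p - psi m p.
Proof.
elim: k m p => [|k IHk] m p agree /=; first by rewrite !subrr.
rewrite addrAC [RHS]addrAC (IHk _ _ agree); congr (_ + _); apply: eq_bigr => y _.
case: m agree => // m agree; case: ifP => // cy.
have := IHk m (p + lw y) (fun m' p' lt => agree m' p' (ltnW lt)).
by rewrite agree // => /addIr.
Qed.

(** In degree [m] the equation reads (1 - q^m) phi_m = lower terms, so it is solved uniquely from
    phi_0. *)
Lemma fixed_by_block_uniq N phi psi :
  fixed_by_block N phi -> fixed_by_block N psi ->
  (forall p, ch p -> phi 0 p = psi 0 p) ->
  forall m p, (m <= N)%N -> ch p -> phi m p = psi m p.
Proof.
move=> Hphi Hpsi base; elim/ltn_ind => m IHm p mN cp.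
have [->|m0] := posnP m; first exact: base.
have := @block_sub_head (dilate phi) (dilate psi) (2 * n) m p.
rewrite -Hphi // -Hpsi // /dilate => E.
apply: (mulfI (one_sub_qX_neq0 q_gt1 m0)); rewrite !mulrBl !mul1r; apply: E.
by move=> m' p' lt cp'; rewrite IHm // (leq_trans _ mN) // ltnW.
Qed.

End WordRecursion.

(** * Blocks without walls *)

Section FreeBlock.
Variables (n : nat) (R : comNzRingType).
Local Notation V := {ffun 'I_n -> int}.
Implicit Types (phi : nat -> V -> R) (A L : {set letter n}).

Definition lws A : V := \sum_(y in A) lw y.
Definition high k : {set letter n} := [set y | (2 * n - k <= letter_rank y)%N].

Definition shift_term phi m p A : R :=
  if (#|A| <= m)%N then phi (m - #|A|)%N (p + lws A) else 0.

Lemma sum_subsetU1 (F : {set letter n} -> R) y L : y \notin L ->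
  \sum_(A : {set letter n} | A \subset y |: L) F A
   = \sum_(A : {set letter n} | A \subset L) (F A + F (y |: A)).
Proof.
move=> yL; rewrite (bigID (fun A : {set letter n} => y \in A)) /= addrC big_split /=; congr (_ + _).
  apply: eq_bigl => A; apply/andP/idP => [[/subsetP s yA]|s].
    by apply/subsetP => z zA; have := s z zA; rewrite !inE => /predU1P[zy|//]; rewrite -zy zA in yA.
  by split; [rewrite subsetU // s orbT|apply: contra yL => /(subsetP s)].
rewrite (reindex_onto (fun A => y |: A) (fun A => A :\ y)) /= => [|A /andP[_ yA]]; last first.
  by rewrite setD1K.
apply: eq_bigl => A; rewrite setU11 andbT; apply/andP/idP => [[s /eqP e]|s].
  have yA : y \notin A by rewrite -e setD11.
  by rewrite -e -(setU1K yL); apply: setSD.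
have yA : y \notin A by apply: contra yL => /(subsetP s).
by rewrite setU1K // eqxx setUS.
Qed.

(** Without walls the shifts commute, so the product of the factors 1 + u y expands over subsets of
    the letters. *)
Lemma free_blockE phi k m p : (k <= 2 * n)%N ->
  block predT phi k m p = \sum_(A : {set letter n} | A \subset high k) shift_term phi m p A.
Proof.
elim: k m p => [|k IHk] m p kn.
  rewrite (big_pred1 set0) => [|A].
    by rewrite /shift_term cards0 /= subn0 /lws big_set0 addr0.
  have -> : high 0 = set0.
    by apply/setP => y; rewrite !inE subn0 leqNgt letter_rank_lt.
  by rewrite subset0.
have kr : (2 * n - k.+1 < 2 * n)%N by lia.
have [y yk] := letter_rankP kr.
have yE z : (letter_rank z == (2 * n - k.+1)%N) = (z == y).
  by rewrite -yk (inj_eq (@letter_rank_inj n)).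
have hE : high k.+1 = y |: high k.
  apply/setP => z; rewrite !inE -yE; have := letter_rank_lt z; move: kn; clear.
  by move=> *; apply/idP/orP => [|[/eqP|]]; [case: eqP => ?; [left|right]| |]; lia.
have yh : y \notin high k by rewrite inE yk; lia.
rewrite hE sum_subsetU1 // big_split /= IHk 1?ltnW //; congr (_ + _).
rewrite (eq_bigl _ _ yE) big_pred1_eq.
have cU A : A \subset high k -> #|y |: A| = #|A|.+1.
  by move=> s; rewrite cardsU1 (contra _ yh) // => /(subsetP s).
case: m => [|m].
  by rewrite big1 // => A s; rewrite /shift_term cU.
rewrite IHk 1?ltnW //; apply: eq_bigr => A s; rewrite /shift_term cU // ltnS subSS.
case: ifP => // _; congr (phi _ _); rewrite -addrA; congr (_ + _).
by rewrite /lws big_setU1 // (contra _ yh) // => /(subsetP s).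
Qed.

Lemma high_full : high (2 * n) = setT.
Proof. by apply/setP => y; rewrite !inE subnn. Qed.

End FreeBlock.

(** * The Weyl chamber and its walls *)

Section Chamber.
Variable n : nat.
Local Notation V := {ffun 'I_n -> int}.
Implicit Types (p : V) (y : letter n) (A L : {set letter n}).

Definition chamber p : bool := is_partition_vec (fun t => p t - rho t).

Lemma chamberP p : reflect
  ((forall t, rho t <= p t) /\ (forall i j : 'I_n, (i <= j)%N -> p j - rho j <= p i - rho i))
  (chamber p).
Proof.
apply: (iffP andP) => [[/forallP H1 /forallP H2]|[H1 H2]]; split.
- by move=> t; have := H1 t; rewrite subr_ge0.
- by move=> i j ij; have /forallP/(_ j) := H2 i; rewrite ij.
- by apply/forallP => t; rewrite subr_ge0.
- by apply/forallP => i; apply/forallP => j; apply/implyP => ij; apply: H2.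
Qed.

Lemma rho_gt0 (t : 'I_n) : 0 < rho t.
Proof. by rewrite /rho; have := ltn_ord t; lia. Qed.

Lemma chamber_gt0 p t : chamber p -> 0 < p t.
Proof. by move=> /chamberP[H _]; apply: lt_le_trans (H t); apply: rho_gt0. Qed.

Lemma chamber_lt p (i j : 'I_n) : chamber p -> (i < j)%N -> p j < p i.
Proof.
move=> /chamberP[_ H] ij; have := H i j (ltnW ij); rewrite /rho.
by have := ltn_ord j; lia.
Qed.

Lemma chamber_inj p : chamber p -> injective p.
Proof.
move=> cp i j E; apply: val_inj; case: (ltngtP i j) => // /(chamber_lt cp);
  by rewrite E ltxx.
Qed.

Definition vperm (s : 'S_n) p : V := [ffun t => p (s t)].

Definition letter_perm (s : 'S_n) y : letter n :=
  match y with inl i => inl (s i) | inr i => inr (s i) end.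

Lemma letter_permK s : cancel (letter_perm s) (letter_perm s^-1%g).
Proof. by case=> i /=; rewrite permK. Qed.

Lemma lwsE A t : lws A t = (inl t \in A)%:Z - (inr t \in A)%:Z.
Proof.
rewrite /lws sum_ffunE.
under eq_bigr => y _ do rewrite ffunE.
rewrite big_sumType /=; congr (_ + _).
  rewrite big_mkcond (bigD1 t) //= eqxx big1 ?addr0; first by case: ifP.
  by move=> i /negbTE ->; rewrite if_same.
rewrite big_mkcond (bigD1 t) //= eqxx big1 ?addr0; first by case: ifP.
by move=> i /negbTE ->; rewrite oppr0 if_same.
Qed.

Lemma lws_perm (s : 'S_n) A : vperm s (lws (letter_perm s @: A)) = lws A.
Proof.
have inj := can_inj (letter_permK s).
apply/ffunP => t; rewrite ffunE !lwsE.
by rewrite -[inl (s t)]/(letter_perm s (inl t)) -[inr (s t)]/(letter_perm s (inr t)) !mem_imset.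
Qed.

(* An illegal step from the chamber lands on a wall which the later letters of the block
   respect: two equal entries exchanged by a symmetry of those letters, or an entry 0
   that they do not touch. *)
Lemma chamber_exit p y : chamber p -> ~~ chamber (p + lw y) ->
  (exists i j : 'I_n, [/\ i != j, (p + lw y) i = (p + lw y) j &
     forall z, (letter_rank y < letter_rank (letter_perm (tperm i j) z))%N
                = (letter_rank y < letter_rank z)%N])
  \/ (exists2 i : 'I_n, (p + lw y) i = 0 &
     forall z, (letter_rank y < letter_rank z)%N -> z != inl i /\ z != inr i).
Proof.
move=> cp ncp; have [p_ge p_le] := chamberP _ cp.
have val_tperm (i j k : 'I_n) : val (tperm i j k) =
    if k == i then val j else if k == j then val i else val k.
  by rewrite permE /=; case: ifP => // _; case: ifP.
case: y ncp => i ncp.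
  (* A raising step leaves the chamber only by making entry [i] equal to entry i - 1. The letters
     after i contain neither i - 1 nor i, but both barred ones, hence the symmetry. *)
  have [j [ji pj]] : exists j : 'I_n, j.+1 = i :> nat /\ p j = p i + 1.
    have [j /andP[ji pj]] : exists j : 'I_n, (j < i)%N && (p j - rho j == p i - rho i).
      apply/existsP; apply: contraR ncp => /existsPn no; apply/chamberP; split.
        by move=> t; rewrite !ffunE /=; have := p_ge t; case: eqP => _ /=; lia.
      move=> j k jk; rewrite !ffunE /=; have := p_le j k jk.
      have [ik|ik] := eqVneq i k; have [ij|ij] := eqVneq i j => /=; try lia.
      have lt : (j < i)%N by rewrite ltn_neqAle eq_sym ij ik.
      by have := no j; rewrite lt /= => /eqP; subst k; lia.
    have ji' : (i.-1 < n)%N by have := ltn_ord i; lia.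
    exists (Ordinal ji'); split => /=; first by lia.
    have h1 := p_le j (Ordinal ji'); have h2 := p_le (Ordinal ji') i.
    move: h1 h2 pj; rewrite /rho /=; have := ltn_ord i; lia.
  left; exists j, i; split.
  - by apply/eqP => E; move: ji; rewrite E; lia.
  - have ne : i != j by apply/eqP => E; move: ji; rewrite E; lia.
    by rewrite !ffunE /= eqxx (negbTE ne) pj addr0.
  case=> k /=; last first.
    have T (k' : 'I_n) : (i < 2 * n - 1 - k')%N = true.
      by have := ltn_ord k'; have := ltn_ord i; lia.
    by rewrite !T.
  have := val_tperm j i k => /= ->; rewrite -!val_eqE /=.
  by case: eqP => [->|_]; [|case: eqP => [->|_]]; apply/idP/idP; lia.
(* A lowering step leaves it either by bringing the last entry to 0 or by making entry [i] equal to
   entry i + 1. *)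
have [[pi i_last]|[j [ij pj]]] : (p i = 1 /\ i.+1 = n) \/
    exists j : 'I_n, i.+1 = j :> nat /\ p j = p i - 1.
  have [iN|iN] := eqVneq i.+1 n.
    left; split=> //; apply/eqP; apply: contraR ncp => pi; apply/chamberP; split.
      move=> t; rewrite !ffunE /=; have := p_ge t; case: eqP => [<-|_] /=; last by lia.
      by move: pi; rewrite /rho; lia.
    move=> j k jk; rewrite !ffunE /=; have := p_le j k jk.
    have [ik|ik] := eqVneq i k; have [ij|ij] := eqVneq i j => /=; try lia.
    by subst j; move: ik; rewrite -val_eqE /= => /eqP; have := ltn_ord k; lia.
  have iN' : (i.+1 < n)%N by have := ltn_ord i; lia.
  right; exists (Ordinal iN'); split=> //; apply/eqP; apply: contraR ncp => pj.
  have strict : p (Ordinal iN') - rho (Ordinal iN') < p i - rho i.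
    rewrite lt_neqAle p_le ?andbT //=; apply: contra pj => /eqP.
    by rewrite /rho /=; lia.
  have above (j : 'I_n) : (i < j)%N -> p j - rho j <= p (Ordinal iN') - rho (Ordinal iN').
    by move=> ij; apply: p_le.
  apply/chamberP; split.
    move=> t; rewrite !ffunE /=; have := p_ge t; case: eqP => [<-|_] /=; last by lia.
    by have := p_ge (Ordinal iN'); lia.
  move=> j k jk; rewrite !ffunE /=; have := p_le j k jk.
  have [ik|ik] := eqVneq i k; have [ij|ij] := eqVneq i j => /=; try lia.
  by have := above k; subst j; move: ik jk; rewrite -val_eqE /=; lia.
- right; exists i; first by rewrite !ffunE /= eqxx pi.
  case=> k /=; have := ltn_ord k; have := ltn_ord i => *; split=> //; try lia.
  by apply/eqP => -[E]; subst k; lia.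
left; exists i, j; split.
- by apply/eqP => E; move: ij; rewrite E; lia.
- have ne : i != j by apply/eqP => E; move: ij; rewrite E; lia.
  by rewrite !ffunE /= eqxx (negbTE ne) pj oppr0 addr0.
case=> k /=.
  have T (k' : 'I_n) : (2 * n - 1 - i < k')%N = false.
    by have := ltn_ord k'; have := ltn_ord i; lia.
  by rewrite !T.
have := val_tperm i j k => /= ->; rewrite -!val_eqE /=.
have := ltn_ord i; have := ltn_ord j; have := ltn_ord k.
by case: eqP => [->|_]; [|case: eqP => [->|_]] => *; apply/idP/idP; lia.
Qed.

End Chamber.

Section BlockOnChamber.
Variables (n : nat) (K : numFieldType).
Local Notation V := {ffun 'I_n -> int}.
Implicit Types (phi : nat -> V -> K).

Definition alternating phi :=
  (forall m (p : V) (i j : 'I_n), i != j -> phi m (vperm (tperm i j) p) = - phi m p) /\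
  (forall m (p : V) (i : 'I_n), p i = 0 -> phi m p = 0).

(** The exchange of [i] and [j] fixes [p], permutes the subsets of [L] and reverses each term. *)
Lemma sum_shift_wall phi m (p : V) (L : {set letter n}) (i j : 'I_n) :
  alternating phi -> i != j -> p i = p j ->
  (forall z, (letter_perm (tperm i j) z \in L) = (z \in L)) ->
  \sum_(A : {set letter n} | A \subset L) shift_term phi m p A = 0.
Proof.
move=> [phi_alt _] ne pij Lst; set s := tperm i j; apply: eq_oppr0.
have inj := can_inj (letter_permK s).
rewrite {1}(reindex_inj (imset_inj inj)) -sumrN; apply: eq_big => A.
  apply/subsetP/subsetP => H z zA; last first.
    by move: zA => /imsetP[y yA ->]; rewrite Lst; apply: H.
  by rewrite -Lst; apply: H; apply: imset_f.
move=> _; rewrite /shift_term card_imset //; case: ifP => _; last by rewrite oppr0.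
rewrite -(phi_alt _ _ i j) //; congr (phi _ _); apply/ffunP => t; rewrite !ffunE.
have E := congr1 (fun f : V => f (s t)) (lws_perm s A).
congr (_ + _); first by rewrite /s; case: tpermP => [->|->|].
by rewrite -E ffunE /s tpermK.
Qed.

(** By [chamber_exit], what a free block would add after an illegal step is a sum based at a wall,
    which vanishes for alternating functions. *)
Lemma block_chamber phi k m (p : V) : alternating phi -> (k <= 2 * n)%N -> chamber p ->
  block (@chamber n) phi k m p = block predT phi k m p.
Proof.
move=> alt; elim: k m p => // k IHk m p kn cp /=.
rewrite IHk 1?ltnW //; congr (_ + _); apply: eq_bigr => y /eqP yk.
case: m => // m; case: ifP => [cy|/negbT ncy]; first by rewrite IHk // ltnW.
have high_y z : (z \in high n k) = (letter_rank y < letter_rank z)%N.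
  by rewrite inE yk; apply/idP/idP; lia.
rewrite free_blockE; last exact: ltnW.
have [[i [j [ne pij sym]]]|[i pi untouched]] := chamber_exit cp ncy.
  rewrite (sum_shift_wall _ alt ne pij) // => z.
  by rewrite !high_y.
rewrite big1 // => A AL; rewrite /shift_term; case: ifP => // _.
rewrite (alt.2 _ _ i) // ffunE pi lwsE add0r.
have not_in z : (z == inl i) || (z == inr i) -> z \notin A.
  move=> zi; apply/negP => /(subsetP AL); rewrite high_y => /untouched[].
  by case/orP: zi => -> .
by rewrite !(negbTE (not_in _ _)) // eqxx ?orbT.
Qed.

End BlockOnChamber.

(** * The closed form for words ending at the empty shape *)

Section SchurWords.
Variables (n : nat) (K : numFieldType) (q : K).
Hypothesis q_gt1 : 1 < q.
Local Notation V := {ffun 'I_n -> int}.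
Local Notation D := (row_det (ecoef q)).

(** Distinct positive entries have nonnegative size; otherwise a row vanishes or two rows
    coincide. *)
Lemma row_det_size_neg (p : 'I_n -> int) : psize p < 0 -> D p = 0.
Proof.
move=> pneg; have [/existsP[i pi]|/existsPn pos] := boolP [exists i, p i <= 0].
  by rewrite (row_det_nonpos (@ecoef_neg _ q) pi).
have [p_inj|[i [j [ne pij]]]] := nat_injective_dec p.
  have p_pos i : 0 < p i by rewrite ltNge.
  by have := psize_ge0 p_inj p_pos; rewrite leNgt pneg.
exact: row_det_alt ne pij.
Qed.

Lemma alternating_dilate (phi : nat -> V -> K) : alternating phi -> alternating (dilate q phi).
Proof.
move=> [H1 H2]; split=> m p i *; rewrite /dilate; first by rewrite H1 ?mulrN.
by rewrite (H2 m p i) ?mulr0.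
Qed.

Definition schur_words (m : nat) (p : V) : K := cx q (m%:Z - psize p) * D p.

Lemma alternating_schur_words : alternating schur_words.
Proof.
split=> [m p i j ne|m p i pi]; rewrite /schur_words; last first.
  by rewrite (row_det_nonpos (@ecoef_neg _ q) (_ : p i <= 0)) ?mulr0 // pi.
rewrite -mulrN -(row_det_tperm _ _ ne); congr (cx q (_ - _) * _).
  rewrite /psize; congr (_ - _); rewrite [RHS](reindex_inj (@perm_inj _ (tperm i j))).
  by apply: eq_bigr => t _; rewrite ffunE.
by apply: eq_row_det => t; rewrite ffunE.
Qed.

Definition letter_set (x : {set 'I_n} * {set 'I_n}) : {set letter n} :=
  [set y | match y with inl i => i \in x.1 | inr i => i \in x.2 end].

Lemma sum_letter_set (F : {set letter n} -> K) :
  \sum_A F A = \sum_(S : {set 'I_n}) \sum_(T : {set 'I_n}) F (letter_set (S, T)).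
Proof.
rewrite pair_bigA (reindex letter_set) /=; first by apply: eq_bigr => -[].
exists (fun A : {set letter n} =>
    ([set i : 'I_n | inl i \in A], [set i : 'I_n | inr i \in A])) => [[S T] _|A _].
  by congr (_, _); apply/setP => i; rewrite !inE.
by apply/setP => -[] i; rewrite !inE.
Qed.

Lemma card_letter_set S T : #|letter_set (S, T)| = (#|S| + #|T|)%N.
Proof.
rewrite -sum1_card big_sumType /= -!sum1_card.
by congr (_ + _)%N; apply: eq_bigl => i; rewrite inE.
Qed.

(** [conv_h_c] written for [cx], with the summation range padded by zeros. *)
Lemma sum_h_ux (x : int) : x <= n%:Z ->
  \sum_(s < n.+1) hcoef q s * ux q (x - s.*2%:Z) = cx q x.
Proof.
case: (cxP q_gt1 x) => [x0 _|M -> Mn].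
  have := x0 0%N; rewrite subr0 => ->; rewrite big1 // => s _.
  by rewrite /ux x0 !mulr0.
rewrite cx_double -(conv_h_c q_gt1) /conv.
have Mn1 : (M.+1 <= n.+1)%N by lia.
rewrite (big_ord_widen _ (fun s => hcoef q s * (q ^+ (M - s).*2 * ccoef q (M - s))) Mn1).
rewrite [RHS]big_mkcond; apply: eq_bigr => s _; rewrite ltnS.
case: leqP => sM; last by rewrite ux_neg ?mulr0 //; lia.
rewrite /ux (_ : M.*2%:Z - s.*2%:Z = (M - s).*2%:Z); last by lia.
by rewrite cx_double -exprnP.
Qed.

(** A block raises the coordinates in [S] and lowers those in [T]. The sum over [T] is
    [sum_remove_strip], the sum over [S] is the Pieri rule, and the functional equation of C
    finishes. *)
Lemma schur_words_fixed : fixed_by_block q (@chamber n) n schur_words.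
Proof.
move=> m p mn cp; have alt := alternating_dilate alternating_schur_words.
rewrite (block_chamber _ alt) // free_blockE // high_full.
under eq_bigl => A do rewrite subsetT.
rewrite sum_letter_set; pose x : int := m%:Z - psize p.
have p_pos i : 0 < p i := chamber_gt0 i cp.
have size_p : 0 <= psize p := psize_ge0 (chamber_inj cp) p_pos.
transitivity (\sum_(S : {set 'I_n}) cx q (x - #|S|.*2%:Z) * q ^ (m%:Z - #|S|%:Z) *
   (\sum_(T : {set 'I_n}) q ^- #|T| * D (fun t => p t + (t \in S)%:Z - (t \in T)%:Z))); last first.
  apply: eq_bigr => S _; rewrite mulr_sumr; apply: eq_bigr => T _.
  pose p' t : int := p t + (t \in S)%:Z - (t \in T)%:Z.
  have sum_in (A : {set 'I_n}) : \sum_t (t \in A)%:Z = #|A|%:Z.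
    rewrite -(big_morph Posz PoszD (erefl _)) -sum1_card [in RHS]big_mkcond.
    by congr Posz; apply: eq_bigr => t _; case: (t \in A).
  have size_p' : psize p' = psize p + #|S|%:Z - #|T|%:Z.
    by rewrite /p' !psizeD sumrN !sum_in.
  rewrite /shift_term card_letter_set /dilate /schur_words.
  have pE : p + lws (letter_set (S, T)) =1 p'.
    by move=> t; rewrite ffunE lwsE !inE addrA.
  have psE : psize (p + lws (letter_set (S, T))) = psize p'.
    by rewrite /psize; congr (_ - _); apply: eq_bigr => t _; rewrite pE.
  rewrite psE (eq_row_det _ pE) size_p'.
  (* Blocks longer than [m] may be included: either the argument of [cx] is negative, or the new
     size is and the determinant vanishes. *)
  case: leqP => ST; last first.
    have [cx0|sx] := ltrP (x - #|S|.*2%:Z) 0; first by rewrite cx_neg // !mul0r.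
    by rewrite row_det_size_neg ?mulr0 // size_p'; move: sx; rewrite /x; lia.
  rewrite (_ : _ - (_ - _) = x - #|S|.*2%:Z); last by rewrite /x; lia.
  rewrite (_ : m%:Z - #|S|%:Z = (m - (#|S| + #|T|))%N%:Z + #|T|%:Z); last by lia.
  rewrite expfzDr ?q_neq0 // -!exprnP.
  have qT : q ^+ #|T| != 0 by rewrite expf_neq0 // q_neq0.
  by move: (cx q _) (D p') (q ^+ (m - _)) (q ^+ #|T|) qT => a b c d d0; field.
transitivity (\sum_(S : {set 'I_n}) ux q (x - #|S|.*2%:Z) * D (fun t => p t + (t \in S)%:Z)).
  rewrite (partition_big (fun S : {set 'I_n} => inord #|S| : 'I_n.+1) xpredT) //=.
  rewrite /schur_words -/x -sum_h_ux; last by rewrite /x; lia.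
  rewrite mulr_suml; apply: eq_bigr => s _.
  have cardE (S : {set 'I_n}) : (inord #|S| == s) = (#|S| == s).
    have Sn : (#|S| < n.+1)%N by rewrite ltnS -[n in (_ <= n)%N]card_ord max_card.
    by rewrite -val_eqE /= inordK.
  rewrite (eq_bigl _ _ cardE).
  transitivity (\sum_(S : {set 'I_n} | #|S| == s) ux q (x - s.*2%:Z) * D (fun t => p t + (t \in S)%:Z)).
    rewrite -mulr_sumr; have [neg|nneg] := ltrP (x - s.*2%:Z) 0.
      by rewrite ux_neg // mulr0 !mul0r.
    (* A nonnegative argument gives psize p + 2 s at most m, so the Pieri rule stays within size
       [n]. *)
    rewrite pieri_e //; last by move: nneg; rewrite /x; lia.
    by move: (hcoef q s) (ux q _) (D p) => *; ring.
  by apply: eq_bigr => S /eqP ->.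
apply: eq_bigr => S _; rewrite sum_remove_strip //.
have -> : psize (fun t => p t + (t \in S)%:Z) = psize p + #|S|%:Z.
  rewrite psizeD -(big_morph Posz PoszD (erefl _)) -sum1_card [in RHS]big_mkcond.
  by congr (_ + Posz _); apply: eq_bigr => t _; case: (t \in S).
rewrite /ux (_ : x - #|S|.*2%:Z = m%:Z - #|S|%:Z + - (psize p + #|S|%:Z)); last by rewrite /x; lia.
rewrite expfzDr ?q_neq0 //.
by move: (q ^ _) (q ^ _) (cx q _) (D _) => *; ring.
Qed.

End SchurWords.

(** * Exchanging the ends of the words *)

Lemma increasing_perm n (s : 'S_n) :
  (forall i j : 'I_n, (i < j)%N -> (s i < s j)%N) -> s = 1%g.
Proof.
have le_incr (t : 'S_n) : (forall i j : 'I_n, (i < j)%N -> (t i < t j)%N) ->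
    forall i : 'I_n, (i <= t i)%N.
  move=> incr; suff H k (lt : (k < n)%N) : (k <= t (Ordinal lt))%N by case=> k lt; apply: H.
  elim: k lt => // k IHk lt.
  exact: leq_ltn_trans (IHk (ltnW lt)) (incr (Ordinal (ltnW lt)) (Ordinal lt) (leqnn _)).
move=> incr; apply/permP => i; rewrite perm1; apply/val_inj/eqP; rewrite /= eqn_leq le_incr //.
rewrite andbT -{2}(permK s i); apply: le_incr => j k jk.
rewrite ltnNge leq_eqVlt negb_or; apply/andP; split.
  apply: contraTN jk => /eqP/val_inj/perm_inj ->; by rewrite ltnn.
by apply: contraTN jk => /incr; rewrite !permKV -leqNgt => /ltnW.
Qed.

Section Rho.
Variable n : nat.
Local Notation V := {ffun 'I_n -> int}.
Implicit Type p : V.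

Definition rhoV : V := [ffun t => rho t].

Lemma chamber_rho : chamber rhoV.
Proof.
by apply/chamberP; split=> [t|i j ij]; rewrite !ffunE ?subrr.
Qed.

Lemma psize_rho p : psize p = \sum_t (p t - rho t).
Proof.
rewrite sumrB /psize; congr (_ - _).
rewrite (big_morph Posz PoszD (erefl _)) [LHS](reindex_inj rev_ord_inj).
by apply: eq_bigr => i _; rewrite /rho /=; have := ltn_ord i; lia.
Qed.

End Rho.

(** * Unrestricted words and the Weyl group of type C *)

Section WeylSum.
Variables (n : nat) (K : numFieldType) (q : K).
Hypothesis q_gt1 : 1 < q.
Local Notation V := {ffun 'I_n -> int}.
Implicit Types (p l : V) (s : 'S_n) (eps : {ffun 'I_n -> bool}).

Definition free_words : nat -> V -> K := norm_words q predT 0.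

Lemma free_words_fixed m p :
  free_words m p = \sum_A shift_term (dilate q free_words) m p A.
Proof.
rewrite /free_words (@norm_words_fixed _ _ _ q_gt1 predT m) // free_blockE // high_full.
by apply: eq_bigl => A; rewrite subsetT.
Qed.

(** The energy depends on the order of the letters, but the free block equation involves only the
    full set of letters. Uniqueness therefore gives the symmetry. *)
Lemma free_words_inv (g : V -> V) (pi : letter n -> letter n) m p :
  injective pi -> (forall p A, g (p + lws A) = g p + lws (pi @: A)) ->
  (forall p, (g p == 0) = (p == 0)) -> free_words m (g p) = free_words m p.
Proof.
move=> pi_inj g_add g0.
apply: (@fixed_by_block_uniq _ _ _ q_gt1 predT m (fun m p => free_words m (g p))) => //.
- move=> m' p' _ _; rewrite free_words_fixed free_blockE // high_full.
  under [RHS]eq_bigl => A do rewrite subsetT.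
  rewrite (reindex_inj (imset_inj pi_inj)) /=; apply: eq_bigr => A _.
  by rewrite /shift_term card_imset // /dilate g_add.
- exact: norm_words_fixed.
by move=> p' _; rewrite /free_words /norm_words /= g0.
Qed.

Lemma vpermD s p p' : vperm s (p + p') = vperm s p + vperm s p'.
Proof. by apply/ffunP => t; rewrite !ffunE. Qed.

Lemma vpermB s p p' : vperm s (p - p') = vperm s p - vperm s p'.
Proof. by apply/ffunP => t; rewrite !ffunE. Qed.

Lemma vpermKV s p : vperm s (vperm s^-1%g p) = p.
Proof. by apply/ffunP => t; rewrite !ffunE permK. Qed.

Lemma free_words_perm s m p : free_words m (vperm s p) = free_words m p.
Proof.
apply: (@free_words_inv (vperm s) (letter_perm s^-1%g)) => [|p' A|p'].
- exact: can_inj (letter_permK _).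
- by rewrite vpermD -(lws_perm s^-1%g A) vpermKV.
apply/eqP/eqP => [E|->]; apply/ffunP => t; rewrite !ffunE //.
by have := congr1 (fun f : V => f (s^-1%g t)) E; rewrite !ffunE permKV.
Qed.

Definition vsgn eps p : V := [ffun t => (-1) ^+ eps t * p t].

Definition letter_sgn eps (y : letter n) : letter n :=
  match y with
  | inl i => if eps i then inr i else inl i
  | inr i => if eps i then inl i else inr i
  end.

Lemma letter_sgnK eps : involutive (letter_sgn eps).
Proof. by move=> [i|i] /=; case e: (eps i) => /=; rewrite e. Qed.

Lemma vsgnK eps : involutive (vsgn eps).
Proof. by move=> p; apply/ffunP => t; rewrite !ffunE signrMK. Qed.

Lemma vsgnD eps p p' : vsgn eps (p + p') = vsgn eps p + vsgn eps p'.
Proof. by apply/ffunP => t; rewrite !ffunE mulrDr. Qed.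

Lemma vsgnB eps p p' : vsgn eps (p - p') = vsgn eps p - vsgn eps p'.
Proof. by apply/ffunP => t; rewrite !ffunE mulrBr. Qed.

Lemma lws_sgn eps (A : {set letter n}) : lws (letter_sgn eps @: A) = vsgn eps (lws A).
Proof.
have mem z : (z \in letter_sgn eps @: A) = (letter_sgn eps z \in A).
  by rewrite -{1}(letter_sgnK eps z) mem_imset //; apply: inv_inj (letter_sgnK eps).
apply/ffunP => t; rewrite ffunE !lwsE !mem /=.
by case: (eps t); rewrite ?expr1 ?expr0 ?mul1r // mulN1r opprB.
Qed.

Lemma free_words_sgn eps m p : free_words m (vsgn eps p) = free_words m p.
Proof.
apply: (@free_words_inv (vsgn eps) (letter_sgn eps)) => [|p' A|p'].
- exact: inv_inj (letter_sgnK eps).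
- by rewrite vsgnD lws_sgn.
have v0 : vsgn eps 0 = 0 by apply/ffunP => t; rewrite !ffunE mulr0.
by rewrite -[X in _ == X]v0 (inj_eq (inv_inj (vsgnK eps))).
Qed.

Lemma free_wordsN m p : free_words m (- p) = free_words m p.
Proof.
rewrite -(free_words_sgn [ffun=> true]); congr free_words; apply/ffunP => t.
by rewrite !ffunE expr1 mulN1r opprK.
Qed.

(* Sum over the Weyl group of type C: the antisymmetrisation of the free words. *)
Definition weyl_words l m p : K :=
  \sum_(s : 'S_n) \sum_(eps : {ffun 'I_n -> bool})
    (-1) ^+ odd_perm s * (-1) ^+ (\sum_t eps t)%N *
      free_words m (p - vsgn eps (vperm s l)).

(** Moving a group element to the other end replaces it by its inverse, of equal sign; [free_words]
    is even and invariant. *)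
Lemma weyl_wordsC l m p : weyl_words l m p = weyl_words p m l.
Proof.
rewrite [RHS](reindex_inj (@invg_inj _)); apply: eq_bigr => s _ /=.
(* The inverse of the signed permutation given by [s] and [eps] has the signs eps (s^-1 t). *)
pose h eps : {ffun 'I_n -> bool} := [ffun t => eps (s^-1%g t)].
have h_inj : injective h.
  move=> e e' E; apply/ffunP => t.
  by have := congr1 (fun f : {ffun 'I_n -> bool} => f (s t)) E; rewrite !ffunE permK.
rewrite [RHS](reindex_inj h_inj); apply: eq_bigr => eps _ /=.
rewrite odd_permV; congr (_ * (-1) ^+ _ * _).
  rewrite [LHS](reindex_inj (@perm_inj _ s^-1%g)) /=.
  by apply: eq_bigr => t _; rewrite ffunE.
rewrite -(free_words_sgn eps) vsgnB vsgnK -(free_words_perm s^-1%g) vpermB.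
rewrite -free_wordsN opprB; congr (free_words _ (_ - _)); apply/ffunP => t.
  by rewrite !ffunE permKV.
by rewrite !ffunE.
Qed.

(** Composition with a reflection reverses all signs of the group elements; the reflection in
    coordinate [i] fixes [p] when [p i = 0]. *)
Lemma alternating_weyl_words l : alternating (weyl_words l).
Proof.
split=> [m p i j ne|m p i pi0].
  set tau := tperm i j; rewrite /weyl_words [LHS](reindex_inj (mulgI tau)) -sumrN.
  apply: eq_bigr => s _ /=.
  pose h eps : {ffun 'I_n -> bool} := [ffun t => eps (tau t)].
  have hK : involutive h by move=> e; apply/ffunP => t; rewrite !ffunE tpermK.
  rewrite [LHS](reindex_inj (inv_inj hK)) -sumrN; apply: eq_bigr => eps _ /=.
  rewrite odd_permM odd_tperm ne signr_addb expr1 mulN1r !mulNr.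
  congr (- (_ * (-1) ^+ _ * _)).
    rewrite [RHS](reindex_inj (@perm_inj _ tau)) /=.
    by apply: eq_bigr => t _; rewrite ffunE.
  rewrite -[RHS](free_words_perm tau) vpermB; congr (free_words _ (_ - _)).
  by apply/ffunP => t; rewrite !ffunE permM.
apply: eq_oppr0; rewrite {1}/weyl_words -sumrN; apply: eq_bigr => s _.
pose h eps : {ffun 'I_n -> bool} := [ffun t => if t == i then ~~ eps t else eps t].
have hK : involutive h.
  by move=> e; apply/ffunP => t; rewrite !ffunE; case: eqP => // _; rewrite negbK.
rewrite [LHS](reindex_inj (inv_inj hK)) -sumrN; apply: eq_bigr => eps _ /=.
have -> : (-1) ^+ (\sum_t h eps t)%N = - (-1) ^+ (\sum_t eps t)%N :> K.
  rewrite (bigD1 i) //= [in RHS](bigD1 i) //= !exprD ffunE eqxx.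
  rewrite (eq_bigr (fun t => eps t : nat)); last by move=> t /negbTE ti; rewrite ffunE ti.
  by case: (eps i); rewrite ?expr0 ?expr1; ring.
rewrite mulrN mulNr. congr (- (_ * _)).
rewrite -(free_words_sgn [ffun t => t == i]); congr free_words.
apply/ffunP => t; rewrite !ffunE.
case: eqP => [->|_]; last by rewrite expr0 mul1r.
by rewrite pi0 !sub0r; case: (eps i); rewrite ?expr0 ?expr1; ring.
Qed.

(** The free equation holds for all translates of [free_words], hence for their combination, and
    antisymmetry restores the chamber condition. *)
Lemma weyl_words_fixed l N : fixed_by_block q (@chamber n) N (weyl_words l).
Proof.
move=> m p _ cp; rewrite (block_chamber _ (alternating_dilate q (alternating_weyl_words l))) //.
rewrite free_blockE // high_full; under [RHS]eq_bigl => A do rewrite subsetT.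
transitivity (\sum_(s : 'S_n) \sum_(A : {set letter n}) \sum_(eps : {ffun 'I_n -> bool})
    (-1) ^+ odd_perm s * (-1) ^+ (\sum_t eps t)%N *
      shift_term (dilate q free_words) m (p - vsgn eps (vperm s l)) A).
  apply: eq_bigr => s _; rewrite exchange_big /=; apply: eq_bigr => eps _.
  by rewrite free_words_fixed mulr_sumr.
rewrite exchange_big /=; apply: eq_bigr => A _; rewrite /shift_term.
case: ifP => _; last first.
  by rewrite big1 // => s _; rewrite big1 // => eps _; rewrite mulr0.
rewrite /dilate mulr_sumr; apply: eq_bigr => s _; rewrite mulr_sumr.
by apply: eq_bigr => eps _; rewrite mulrCA addrAC.
Qed.

Lemma free_words0 p : free_words 0 p = (p == 0)%:R.
Proof. by rewrite /free_words /norm_words /= /qfact big_ord0 divr1. Qed.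

(** Only the identity of the Weyl group maps a point of the open chamber into the chamber. *)
Lemma weyl_words0 l p : chamber l -> chamber p -> weyl_words l 0 p = (p == l)%:R.
Proof.
move=> cl cp; pose z : {ffun 'I_n -> bool} := [ffun=> false].
have key s eps : p = vsgn eps (vperm s l) -> s = 1%g /\ eps = z.
  move=> E; have pt t : p t = (-1) ^+ eps t * l (s t) by rewrite E !ffunE.
  have eps0 t : eps t = false.
    apply/negbTE/negP => et; have := chamber_gt0 t cp; have := chamber_gt0 (s t) cl.
    by rewrite pt et expr1 mulN1r; lia.
  split; last by apply/ffunP => t; rewrite eps0 ffunE.
  have pt' t : p t = l (s t) by rewrite pt eps0 mul1r.
  apply: increasing_perm => i j ij; rewrite ltnNge leq_eqVlt negb_or; apply/andP; split.
    by apply: contraTN ij => /eqP/val_inj/perm_inj ->; rewrite ltnn.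
  by apply/negP => /(chamber_lt cl); rewrite -!pt'; have := chamber_lt cp ij; lia.
rewrite /weyl_words (bigD1 1%g) //= [X in _ + X]big1 ?addr0; last first.
  move=> s s1; rewrite big1 // => eps _; rewrite free_words0 subr_eq0.
  by case: eqP => [/key[s1' _]|_]; [rewrite s1' eqxx in s1|rewrite mulr0].
rewrite (bigD1 z) //= [X in _ + X]big1 ?addr0; last first.
  move=> eps e1; rewrite free_words0 subr_eq0.
  by case: eqP => [/key[_ e1']|_]; [rewrite e1' eqxx in e1|rewrite mulr0].
rewrite odd_perm1 expr0 mul1r big1 ?mul1r; last by move=> t _; rewrite ffunE.
rewrite free_words0 subr_eq0; congr (_ == _)%:R.
by apply/ffunP => t; rewrite !ffunE perm1 mul1r.
Qed.

(** The argument of [cx] is -|lambda|, negative unless the shape is empty; there the matrix is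
    unitriangular. *)
Lemma schur_words0 p : chamber p -> schur_words q 0 p = (p == rhoV n)%:R.
Proof.
move=> cp; have [p_ge _] := chamberP _ cp; rewrite /schur_words sub0r.
have [->|ne] := eqVneq p (rhoV n).
  rewrite psize_rho big1 => [|t _]; last by rewrite ffunE subrr.
  rewrite oppr0 (cx_double q 0) mul1r /row_det -det_tr det_lower_unit //.
    move=> i j ij; rewrite !mxE ffunE ecoef_neg // /rho.
    by have := ltn_ord j; lia.
  move=> i; rewrite !mxE ffunE (_ : _ + _ = 0) ?ecoef0 // /rho.
  by have := ltn_ord i; lia.
rewrite cx_neg ?mul0r // oppr_lt0 lt_neqAle eq_sym.
have ge0 t : 0 <= p t - rho t by rewrite subr_ge0.
rewrite psize_rho sumr_ge0 ?andbT //; apply: contraNneq ne => E.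
apply/eqP/ffunP => t; rewrite ffunE; apply/eqP; rewrite -subr_eq0; apply/eqP.
by apply: (psumr_eq0P (fun i _ => ge0 i) E).
Qed.

Lemma norm_words0 (ch : pred V) l p : norm_words q ch l 0 p = (p == l)%:R.
Proof. by rewrite /norm_words /= /qfact big_ord0 divr1. Qed.

(** The words wanted start at the empty shape, whereas the solved equation is for words ending
    there; [weyl_wordsC] exchanges the ends. *)
Lemma word_sum_closed l : chamber l ->
  word_sum q (@chamber n) l n 0 (rhoV n)
  = qfact q n * (cx q (n%:Z - psize l) * row_det (ecoef q) l).
Proof.
move=> cl; have crho := chamber_rho n.
suff E : norm_words q (@chamber n) l n (rhoV n) = schur_words q n l.
  by rewrite -[_ * row_det _ _]/(schur_words q n l) -E /norm_words mulrC divfK // qfact_neq0.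
transitivity (weyl_words l n (rhoV n)).
  apply: (fixed_by_block_uniq q_gt1 (@norm_words_fixed _ _ _ q_gt1 (@chamber n) n l) (@weyl_words_fixed l n)) => //.
  by move=> p cp; rewrite norm_words0 weyl_words0.
rewrite weyl_wordsC.
transitivity (norm_words q (@chamber n) (rhoV n) n l).
  apply: (fixed_by_block_uniq q_gt1 (@weyl_words_fixed (rhoV n) n) (@norm_words_fixed _ _ _ q_gt1 (@chamber n) n (rhoV n))) => //.
  by move=> p cp; rewrite norm_words0 weyl_words0.
apply: (fixed_by_block_uniq q_gt1 (@norm_words_fixed _ _ _ q_gt1 (@chamber n) n (rhoV n)) (@schur_words_fixed n K q q_gt1)) => //.
by move=> p cp; rewrite norm_words0 schur_words0.
Qed.

End WeylSum.

(** * Coefficients, and comparison of polynomials *)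

Section BoxChange.
Variable n : nat.

Definition same_vals B B' (ab : root_mults B n) (ab' : root_mults B' n) : Prop :=
  (forall p, ab.1 p = ab'.1 p :> nat) /\ (forall p, ab.2 p = ab'.2 p :> nat).

Lemma same_vals_triangular B B' (ab : root_mults B n) (ab' : root_mults B' n) :
  same_vals ab ab' -> triangular ab = triangular ab'.
Proof.
by move=> [E1 E2]; congr (_ && _); apply: eq_forallb => p; congr (_ ==> (_ == _));
  [apply: E1|apply: E2].
Qed.

Lemma same_vals_total B B' (ab : root_mults B n) (ab' : root_mults B' n) :
  same_vals ab ab' -> root_total ab = root_total ab'.
Proof. by move=> [E1 E2]; congr (_ + _)%N; apply: eq_bigr => p _; [apply: E1|apply: E2]. Qed.

Lemma same_vals_weight B B' (ab : root_mults B n) (ab' : root_mults B' n) :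
  same_vals ab ab' -> root_weight ab =1 root_weight ab'.
Proof.
by move=> [E1 E2] t; congr (_ - _); apply: eq_bigr => p _; congr (Posz _ * _);
  [apply: E1|apply: E2].
Qed.

(** Multiplicities of total [m] are at most [m], so the boxes of sides [m] and [B] contain the same
    families. *)
Lemma coef_Fbox B (beta : 'I_n -> int) m : (m <= B)%N ->
  (Fbox B ('X : {poly int}) beta)`_m = (Fcoef beta m)%:Z.
Proof.
move=> mB; pose P C (ab : root_mults C n) :=
  [&& triangular ab, root_total ab == m & [forall t, root_weight ab t == beta t]].
have PE C C' (ab : root_mults C n) (ab' : root_mults C' n) :
    same_vals ab ab' -> P C ab = P C' ab'.
  move=> E; rewrite /P (same_vals_triangular E) (same_vals_total E).
  by congr [&& _, _ & _]; apply: eq_forallb => t; rewrite (same_vals_weight E).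
have vle C (ab : root_mults C n) p : P C ab -> (ab.1 p <= m)%N /\ (ab.2 p <= m)%N.
  move=> /and3P[_ /eqP <- _]; rewrite /root_total (bigD1 p) //= [X in (_ + X)%N](bigD1 p) //=.
  by split; lia.
pose h C C' (ab : root_mults C n) : root_mults C' n :=
  ([ffun p => inord (ab.1 p)], [ffun p => inord (ab.2 p)]).
have hP C C' (ab : root_mults C n) : (m <= C')%N -> P C ab -> same_vals (h C C' ab) ab.
  move=> mC Pab; split=> p; have [l1 l2] := vle _ _ p Pab;
  by rewrite /= ffunE inordK // ltnS (leq_trans _ mC).
have hK C C' (ab : root_mults C n) : (m <= C')%N -> P C ab -> h C' C (h C C' ab) = ab.
  move=> mC Pab; have [E1 E2] := hP _ C' _ mC Pab; rewrite /h.
  case: ab Pab E1 E2 => a b Pab E1 E2 /=; congr (_, _); apply/ffunP => p; apply: val_inj;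
    by rewrite ffunE /= ?E1 ?E2 inordK.
transitivity (\sum_(ab : root_mults B n | P B ab) 1%N)%N%:Z.
  rewrite /Fbox coef_sum (big_morph Posz PoszD (erefl _)) big_mkcond [RHS]big_mkcond.
  apply: eq_bigr => ab _; rewrite coefXn /P [m == _]eq_sym.
  move: (triangular ab) [forall t, _ == _] => [] [] //=; rewrite ?andbT ?andbF //.
  by case: eqP.
congr Posz; rewrite (reindex_onto (h m B) (h B m)) => [|ab Pab]; last exact: hK.
rewrite sum1_card; apply: eq_card => ab; rewrite !inE.
transitivity (P m ab); last by rewrite /P /triangular -andbA.
rewrite -[LHS]/(P B (h m B ab) && (h B m (h m B ab) == ab)).
have [Pab|nP] := boolP (P m ab).
  by rewrite hK // eqxx andbT (PE _ _ _ _ (hP _ _ _ mB Pab)).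
apply: contraNF nP => /andP[Pab /eqP E].
by rewrite -E (PE _ _ _ _ (hP _ _ _ _ Pab)).
Qed.

Lemma coef_Ubox B (lam : 'I_n -> nat) m : (m <= B)%N ->
  (Ubox B ('X : {poly int}) (fun i => (lam i)%:Z + rho i))`_m
  = Ucoef lam (fun=> 1%N) m%:Z.
Proof.
move=> mB; rewrite /Ubox /Ucoef coef_sum [RHS](reindex_inj (@invg_inj _)).
apply: eq_bigr => s _ /=; rewrite odd_permV invgK.
have -> (P : {poly int}) : ((-1) ^+ odd_perm s * P)`_m = (-1) ^+ odd_perm s * P`_m.
  by case: (odd_perm s); rewrite ?expr1 ?expr0 ?mul1r // !mulN1r coefN.
by rewrite coef_Fbox.
Qed.

End BoxChange.

Lemma rmorph_Ubox (R S : comNzRingType) (phi : {rmorphism R -> S}) B n (x : R)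
    (p : 'I_n -> int) : phi (Ubox B x p) = Ubox B (phi x) p.
Proof.
rewrite rmorph_sum; apply: eq_bigr => s _; rewrite rmorphM rmorph_sign; congr (_ * _).
by rewrite rmorph_sum; apply: eq_bigr => ab _; rewrite rmorphXn.
Qed.

Lemma rmorph_word_sum (R S : comNzRingType) (phi : {rmorphism R -> S}) n (x : R)
    ch (l : {ffun 'I_n -> int}) m r p :
  phi (word_sum x ch l m r p) = word_sum (phi x) ch l m r p.
Proof.
elim: m r p => [|m IHm] r p /=; first by rewrite rmorph_nat.
rewrite rmorph_sum; apply: eq_bigr => y _.
by rewrite rmorphM rmorphXn IHm.
Qed.

(** * Word sums as sums over paths *)

Section WordExpansion.
Variables (n : nat) (R : comNzRingType) (q : R).
Local Notation V := {ffun 'I_n -> int}.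
Variables (ch : pred V) (l : V).

Definition word_ok m (p : V) (w : {ffun 'I_m -> letter n}) : bool :=
  [forall k : 'I_m, ch (p + \sum_(j < m | (j < k.+1)%N) lw (w j))] &&
  (p + \sum_j lw (w j) == l).

(** The energy with a virtual letter of rank r - 1 in front; [r = 0] means no such letter. *)
Definition word_energy m (r : nat) (w : {ffun 'I_m -> letter n}) : nat :=
  (\sum_(j < m | val j == 0%N) (m - j) * (letter_rank (w j) < r)
   + \sum_(i < m) \sum_(j < m | val j == (val i).+1) (m - j) * Hloc (w i) (w j))%N.

Definition word_cons m (y : letter n) (w : {ffun 'I_m -> letter n}) :
    {ffun 'I_m.+1 -> letter n} :=
  [ffun i => if unlift ord0 i is Some i' then w i' else y].

Lemma sum_word_cons m (F : {ffun 'I_m.+1 -> letter n} -> R) :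
  \sum_w F w = \sum_y \sum_(w : {ffun 'I_m -> letter n}) F (word_cons y w).
Proof.
rewrite pair_bigA (reindex (fun x : letter n * _ => word_cons x.1 x.2)) //=.
exists (fun w : {ffun 'I_m.+1 -> letter n} => (w ord0, [ffun i => w (lift ord0 i)])).
  move=> [y w] _ /=; congr (_, _); first by rewrite ffunE unlift_none.
  by apply/ffunP => i; rewrite !ffunE liftK.
move=> w _; apply/ffunP => i; rewrite ffunE /=.
by case: (unliftP ord0 i) => [j|] ->; rewrite ?ffunE.
Qed.

Lemma word_cons0 m y (w : {ffun 'I_m -> letter n}) : word_cons y w ord0 = y.
Proof. by rewrite ffunE unlift_none. Qed.

Lemma word_consS m y (w : {ffun 'I_m -> letter n}) i : word_cons y w (lift ord0 i) = w i.
Proof. by rewrite ffunE liftK. Qed.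

Lemma word_ok_cons m p y (w : {ffun 'I_m -> letter n}) :
  word_ok p (word_cons y w) = ch (p + lw y) && word_ok (p + lw y) w.
Proof.
have sumE (k : nat) : \sum_(j < m.+1 | (j < k.+1)%N) lw (word_cons y w j) =
    lw y + \sum_(j < m | (j < k)%N) lw (w j).
  rewrite big_mkcond big_ord_recl word_cons0 /=; congr (_ + _).
  by rewrite [RHS]big_mkcond; apply: eq_bigr => j _; rewrite word_consS.
rewrite /word_ok big_ord_recl word_cons0 addrA.
under eq_bigr => j _ do rewrite word_consS.
rewrite andbA; congr (_ && _); apply/forallP/andP => [H|[H0 /forallP H] k].
  split.
    by have := H ord0; rewrite sumE big_pred0 ?addr0.
  apply/forallP => k; have := H (lift ord0 k); rewrite sumE addrA.
  by rewrite /= /bump /= add1n.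
rewrite sumE addrA; case: (unliftP ord0 k) => [k'|] -> /=; last first.
  by rewrite big_pred0 ?addr0.
by rewrite /bump /= add1n.
Qed.

Lemma word_energy_cons m r y (w : {ffun 'I_m -> letter n}) :
  word_energy r (word_cons y w) =
  (m.+1 * (letter_rank y < r) + word_energy (letter_rank y).+1 w)%N.
Proof.
have shift (F : 'I_m.+1 -> nat) k : (\sum_(j < m.+1 | val j == k.+1) F j
    = \sum_(j < m | val j == k) F (lift ord0 j))%N.
  rewrite big_mkcond big_ord_recl /= add0n [RHS]big_mkcond.
  by apply: eq_bigr => j _; rewrite /= /bump add1n eqSS.
rewrite /word_energy; congr (_ + _)%N.
  by rewrite (big_pred1 ord0) ?word_cons0 ?subn0.
rewrite big_ord_recl; congr (_ + _)%N.
  rewrite shift; apply: eq_bigr => j _.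
  by rewrite word_cons0 word_consS /= /bump add1n subSS /Hloc ltnS.
apply: eq_bigr => i _; rewrite shift; apply: eq_bigr => j _.
by rewrite !word_consS /= /bump add1n subSS.
Qed.

Lemma word_sumE m r p :
  word_sum q ch l m r p =
  \sum_(w : {ffun 'I_m -> letter n} | word_ok p w) q ^+ word_energy r w.
Proof.
elim: m r p => [|m IHm] r p.
  pose w0 : {ffun 'I_0 -> letter n} := ffun0 (card_ord 0).
  rewrite big_mkcond (big_pred1 w0) => [|w]; last by apply/esym/eqP/ffunP => -[].
  rewrite /= /word_ok /word_energy !big_ord0 addr0 expr0.
  have -> : [forall k : 'I_0, ch (p + \sum_(j < 0 | (j < k.+1)%N) lw (w0 j))] by apply/forallP => -[].
  by case: eqP.
rewrite [RHS]big_mkcond sum_word_cons /= big_mkcond; apply: eq_bigr => y _.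
case: ifP => cy; last by rewrite big1 // => w _; rewrite word_ok_cons cy.
rewrite IHm mulr_sumr [LHS]big_mkcond; apply: eq_bigr => w _.
by rewrite word_ok_cons cy /=; case: ifP => // _; rewrite word_energy_cons exprD.
Qed.

End WordExpansion.

Section PathsAsWords.
Variables (n : nat) (lam : 'I_n -> nat).

Definition shifted : {ffun 'I_n -> int} := [ffun t => (lam t)%:Z + rho t].

Lemma Eset_word_ok (w : {ffun 'I_n -> letter n}) :
  (w \in Eset lam) = word_ok (@chamber n) shifted (rhoV n) w.
Proof.
have psumE k t : (rhoV n + \sum_(j < n | (j < k)%N) lw (w j)) t - rho t = psum w k t.
  rewrite !ffunE sum_ffunE addrC addKr; apply: eq_bigr => j _; exact: ffunE.
congr (_ && _).
  apply: eq_forallb => k; congr (_ && _).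
    by apply: eq_forallb => t; rewrite psumE.
  apply: eq_forallb => i; apply: eq_forallb => j; congr (_ ==> _).
  by rewrite !psumE.
have psum_n t : psum w n t = (\sum_j lw (w j)) t.
  rewrite sum_ffunE /psum; apply: eq_big => j; first by rewrite ltn_ord.
  by rewrite ffunE.
apply/forallP/eqP => [H|H t].
  by apply/ffunP => t; rewrite !ffunE -psum_n (eqP (H t)) addrC.
have := congr1 (fun f : {ffun 'I_n -> int} => f t) H.
by rewrite !ffunE -psum_n addrC => /addIr ->.
Qed.

Lemma energy_word (w : {ffun 'I_n -> letter n}) : energy w = word_energy 0 w.
Proof.
by rewrite /word_energy big1 ?add0n // => j _; rewrite ltn0 muln0.
Qed.

Lemma coef_word_sum m :
  (word_sum ('X : {poly int}) (@chamber n) shifted n 0 (rhoV n))`_m = Xcoef lam m%:Z.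
Proof.
rewrite word_sumE coef_sum /Xcoef -sum1_card (big_morph Posz PoszD (erefl _)).
rewrite big_mkcond [RHS]big_mkcond; apply: eq_bigr => w _.
rewrite [in RHS]inE Eset_word_ok coefXn energy_word [m == _]eq_sym.
by case: (word_ok _ _ _ _) => //=; case: eqP.
Qed.

Lemma psize_shifted : psize shifted = (\sum_i lam i)%N%:Z.
Proof.
rewrite psize_rho (big_morph Posz PoszD (erefl _)).
by apply: eq_bigr => t _; rewrite ffunE addrK.
Qed.

Lemma chamber_shifted :
  (forall i j : 'I_n, (i <= j)%N -> (lam j <= lam i)%N) -> chamber shifted.
Proof.
move=> mono; apply/chamberP; split=> [t|i j ij]; rewrite !ffunE ?addrK.
  by rewrite lerDr.
by rewrite lez_nat mono.
Qed.

End PathsAsWords.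

(** * Comparison of polynomials by their values *)

Lemma poly_eq0_at_nats (P : {poly rat}) : (forall k : nat, P.[k.+2%:R] = 0) -> P = 0.
Proof.
move=> P0; apply/eqP; apply: contraT => Pn0.
pose rs : seq rat := [seq k.+2%:R | k <- iota 0 (size P)].
have rs_root : all (root P) rs by apply/allP => _ /mapP[k _ ->]; rewrite /root P0.
have rs_uniq : uniq rs.
  rewrite map_inj_uniq ?iota_uniq // => i j /eqP.
  by rewrite eqr_nat !eqSS => /eqP.
by have := max_poly_roots Pn0 rs_root rs_uniq; rewrite size_map size_iota ltnn.
Qed.

(** The points k + 2 are greater than 1, where the closed forms are available. *)
Lemma eq_intpoly_at_nats (P Q : {poly int}) :
  (forall k : nat, (map_poly intr P : {poly rat}).[k.+2%:R] = (map_poly intr Q).[k.+2%:R]) ->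
  P = Q.
Proof.
move=> E; apply: (map_inj_poly (@intr_inj rat)); first by rewrite ?rmorph0.
apply/eqP; rewrite -subr_eq0; apply/eqP; apply: poly_eq0_at_nats => k.
by rewrite hornerD hornerN E subrr.
Qed.

(** At each q = k + 2 the two closed forms share the factors C_M and D and differ by q^(n -
    |lambda|). *)
Lemma Ubox_word_sum n B (lam : 'I_n -> nat) :
  (forall i j : 'I_n, (i <= j)%N -> (lam j <= lam i)%N) -> (n * n <= B)%N ->
  let U := Ubox B ('X : {poly int}) (fun i => (lam i)%:Z + rho i) in
  let X := word_sum ('X : {poly int}) (@chamber n) (shifted lam) n 0 (rhoV n) in
  if (\sum_i lam i <= n)%N then U = 'X^(n - \sum_i lam i) * X else U = 0 /\ X = 0.
Proof.
move=> mono nB U X; have cl := chamber_shifted mono.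
have q1 (k : nat) : (1 : rat) < k.+2%:R by rewrite (ltr_nat _ 1).
pose ev (k : nat) : {rmorphism {poly int} -> rat} := horner_eval k.+2%:R \o map_poly intr.
have X0 (k : nat) : (map_poly intr 'X : {poly rat}).[k.+2%:R] = k.+2%:R.
  by rewrite map_polyX hornerX.
have evU k : (map_poly intr U : {poly rat}).[k.+2%:R] =
    qfact k.+2%:R n * ux k.+2%:R (n%:Z - (\sum_i lam i)%N%:Z)
    * row_det (ecoef k.+2%:R) (shifted lam).
  rewrite [LHS](rmorph_Ubox (ev k)) [ev k 'X]X0 (@Ubox_closed _ _ (q1 k)) //; last first.
    by move=> i; rewrite ltr_wpDl // rho_gt0.
  rewrite -psize_shifted.
  have E : (fun i => (lam i)%:Z + rho i) =1 shifted lam by move=> i; rewrite ffunE.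
  rewrite (eq_row_det _ E); congr (_ * ux _ (_ - _) * _).
  by rewrite /psize; congr (_ - _); apply: eq_bigr => i _; rewrite E.
have evX k : (map_poly intr X : {poly rat}).[k.+2%:R] =
    qfact k.+2%:R n * (cx k.+2%:R (n%:Z - (\sum_i lam i)%N%:Z)
    * row_det (ecoef k.+2%:R) (shifted lam)).
  by rewrite [LHS](rmorph_word_sum (ev k)) [ev k 'X]X0 (word_sum_closed (q1 k)) // psize_shifted.
case: leqP => lam_n.
  apply: eq_intpoly_at_nats => k.
  rewrite evU rmorphM rmorphXn hornerM evX /= map_polyX hornerXn /ux.
  rewrite (_ : n%:Z - _ = (n - \sum_i lam i)%N%:Z); last by rewrite subzn.
  rewrite -exprnP.
  by move: (qfact _ _) (cx _ _) (row_det _ _) (_ ^+ _) => *; ring.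
have neg : n%:Z - (\sum_i lam i)%N%:Z < 0 by rewrite subr_lt0 ltz_nat.
split; apply: eq_intpoly_at_nats => k; rewrite rmorph0 horner0.
  by rewrite evU ux_neg // mulr0 mul0r.
by rewrite evX cx_neg // mul0r mulr0.
Qed.

(* U_{lambda,(1^n)}(q) = q^{n-|lambda|} X_{lambda,(1^n)}(q), compared
   coefficientwise over all integer exponents k. *)
Theorem mainTheorem13 (n : nat) (hn : (0 < n)%N) (lam : 'I_n -> nat)
  (hlam : forall i j : 'I_n, (i <= j)%N -> (lam j <= lam i)%N) (k : int) :
  Ucoef lam (fun _ => 1%N) k
  = Xcoef lam (k - (n%:Z - (\sum_(i < n) lam i)%N%:Z)).
Proof.
(* In negative degree the left side is 0 by [Fq]; on the right the degree is negative as well, or X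
   vanishes because |lambda| > n. *)
case: k => [m|m]; last first.
  rewrite [LHS]big1 => [|s _]; last by rewrite mulr0.
  have [le|gt] := leqP (\sum_(i < n) lam i) n.
    by rewrite (_ : _ - _ = Negz (m + (n - \sum_(i < n) lam i))) //; lia.
  have := Ubox_word_sum hlam (leqnn _); rewrite leqNgt gt /= => -[_ X0].
  case e: (_ - _) => [j|//]; by rewrite -coef_word_sum X0 coef0.
(* This box serves both the closed form, which needs n^2, and the coefficient of degree [m]. *)
have nB : (n * n <= n * n + m)%N := leq_addr _ _.
rewrite -(@coef_Ubox n (n * n + m)) ?leq_addl //.
have := Ubox_word_sum hlam nB; case: leqP => [le|gt] /= => [->|[-> X0]]; last first.
  by rewrite coef0; case: (_ - _) => // j; rewrite -coef_word_sum X0 coef0.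
(* Below degree n - |lambda| the power of 'X gives 0, matching [Xcoef] at a negative exponent. *)
rewrite coefXnM; case: ltnP => lt.
  rewrite (_ : m%:Z - _ = Negz (n - \sum_(i < n) lam i - m).-1) //.
  by move: (\sum_(i < n) lam i)%N le lt => S; lia.
rewrite (_ : m%:Z - _ = (m - (n - \sum_(i < n) lam i))%N%:Z) ?coef_word_sum //.
by rewrite -!subzn.
Qed.
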